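(* Let $k$ be a field and let $A=kQ/I$ be a triangular gentle algebra. Then for all integers $n>1$ and $m>1$, $[{\rm HH}^n(A),{\rm HH}^m(A)]=0$, where $[-,-]$ is the Gerstenhaber bracket on Hochschild cohomology.
   Context: $Q$ is a finite quiver, $I$ an admissible ideal of $kQ$; paths are composed left to right. Triangular means $Q$ has no oriented cycles. $A$ is a string algebra if: (S1) $I$ is generated by paths; (S2) each vertex of $Q$ is the source of at most two arrows and the target of at most two arrows; (S3) for each arrow $\alpha$ there is at most one arrow $\beta$ with $\alpha\beta\notin I$ and at most one arrow $\gamma$ with $\gamma\alpha\notin I$. $A$ is gentle if it is a string algebra satisfying in addition (G1) for each arrow $\alpha$ there is at most one arrow $\beta$ with $\alpha\beta\in I$ and at most one arrow $\gamma$ with $\gamma\alpha\in I$, and (G2) $I$ is generated by paths of length 2. ${\rm HH}^i(A)={\rm Ext}^i_{A\otimes_kA^{op}}(A,A)$. The Gerstenhaber bracket: for Hochschild cochains $f$ of degree $n$ and $g$ of degree $m$, $(f\circ_i g)(r_1\otimes\cdots\otimes r_{n+m-1})=f(r_1\otimes\cdots\otimes r_{i-1}\otimes g(r_i\otimes\cdots\otimes r_{i+m-1})\otimes r_{i+m}\otimes\cdots\otimes r_{n+m-1})$, $f\circ g=\sum_{i=1}^n(-1)^{(i-1)(m-1)}f\circ_i g$ (and $f\circ g=0$ if $n=0$), $[f,g]=f\circ g-(-1)^{(n-1)(m-1)}g\circ f$; this induces a graded Lie bracket of degree $-1$ on ${\rm HH}^*(A)$. *)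

(* Defs.v *)
From HB Require Import structures.
From mathcomp Require Import all_boot all_order all_algebra.
From Stdlib Require List.
Set Implicit Arguments. Unset Strict Implicit. Unset Printing Implicit Defensive.
Import Order.TTheory GRing.Theory Num.Theory.
Local Open Scope ring_scope.

(* Quivers.  A finite quiver Q = (V, E, s, t); paths are composed left *)
(* to right: a path is a sequence [:: a1; ...; an] of arrows with       *)
(* t a_i = s a_(i+1).                                                   *)
Section Quiver.
Variables (V E : finType) (s t : E -> V).

Definition consec (p : seq E) : bool := sorted (fun a b => t a == s b) p.

Definition endv (v : V) (p : seq E) : V :=
  if p is a :: q then t (last a q) else v.

Definition triangular : Prop :=
  forall a p, consec (a :: p) -> s a != t (last a p).

Definition string_S2 : Prop :=
  (forall v, #|[set a | s a == v]| <= 2)%N /\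
  (forall v, #|[set a | t a == v]| <= 2)%N.

(* The ideal I is generated by a set of paths of length 2, given by the
   relation Rel on arrows: (a, b) with Rel a b stands for the path a b. *)
Variable Rel : rel E.

Definition relations_are_paths : Prop := forall a b, Rel a b -> t a = s b.

Definition in_ideal (p : seq E) : bool :=
  has (fun ab => Rel ab.1 ab.2) (zip p (behead p)).

(* I is admissible: R^M \subseteq I for some M (I \subseteq R^2 holds since
   the generators have length 2) *)
Definition admissible : Prop :=
  exists M : nat, forall p : seq E, size p = M -> consec p -> in_ideal p.

Definition string_S3 : Prop :=
  (forall a, #|[set b | (t a == s b) && ~~ Rel a b]| <= 1)%N /\
  (forall a, #|[set c | (t c == s a) && ~~ Rel c a]| <= 1)%N.

Definition gentle_G1 : Prop :=
  (forall a, #|[set b | (t a == s b) && Rel a b]| <= 1)%N /\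
  (forall a, #|[set c | (t c == s a) && Rel c a]| <= 1)%N.

(* (S1) and (G2) hold by construction (I is generated by the length-2
   paths given by Rel). *)

(* The algebra A = kQ/I.  Its basis is the set of paths not in I       *)
(* (including the trivial paths e_v).  A path is encoded by a key      *)
(* (v, p): start vertex v and arrow sequence p.                        *)
Definition pkey := (V * seq E)%type.

Definition valid (q : pkey) : bool :=
  [&& consec q.2, (if q.2 is a :: _ then s a == q.1 else true)
    & ~~ in_ideal q.2].

Variable k : fieldType.

(* k-valued functions on keys; an element of A is such a function
   vanishing outside the valid keys (its coordinates in the path basis) *)
Definition F := pkey -> k.

Definition inA (x : F) : Prop := forall q, ~~ valid q -> x q = 0.

Definition zeroF : F := fun _ => 0.
Definition addF (x y : F) : F := fun q => x q + y q.
Definition scaleF (c : k) (x : F) : F := fun q => c * x q.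
Definition oneF : F := fun q => if q.2 is [::] then 1 else 0.

Definition mulF (x y : F) : F := fun q =>
  if valid q then
    \sum_(i < (size q.2).+1)
       x (q.1, take i q.2) * y (endv q.1 (take i q.2), drop i q.2)
  else 0.

(* Hochschild cochains C^n(A,A) = Hom_k(A^{\otimes n}, A): k-multilinear *)
(* maps A^n -> A, represented as functions on lists of length n.       *)
Definition cochain (n : nat) (f : seq F -> F) : Prop :=
  (forall l, size l = n -> List.Forall inA l -> inA (f l)) /\
  (forall l1 l2 x y c, (size l1 + size l2).+1 = n ->
     List.Forall inA l1 -> List.Forall inA l2 -> inA x -> inA y ->
     forall q, f (l1 ++ addF (scaleF c x) y :: l2) q =
               c * f (l1 ++ x :: l2) q + f (l1 ++ y :: l2) q).

Definition mergeAt (i : nat) (l : seq F) : seq F :=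
  take i l ++ mulF (nth zeroF l i) (nth zeroF l i.+1) :: drop i.+2 l.

Definition hoch_diff (n : nat) (f : seq F -> F) (l : seq F) : F := fun q =>
  mulF (head zeroF l) (f (behead l)) q
  + \sum_(i < n) (-1) ^+ i.+1 * f (mergeAt i l) q
  + (-1) ^+ n.+1 * mulF (f (take n l)) (nth zeroF l n) q.

Definition cocycle (n : nat) (f : seq F -> F) : Prop :=
  cochain n f /\
  forall l, size l = n.+1 -> List.Forall inA l -> forall q, hoch_diff n f l q = 0.

(* f (of degree p.+1) is a coboundary *)
Definition coboundary (p : nat) (f : seq F -> F) : Prop :=
  exists h, cochain p h /\
    forall l, size l = p.+1 -> List.Forall inA l -> forall q, f l q = hoch_diff p h l q.

End Quiver.

(* Gerstenhaber composition and bracket (independent of the algebra).  *)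
(* (f o_i g)(r_1..r_{n+m-1}) = f(r_1..r_{i-1}, g(r_i..r_{i+m-1}), ..),  *)
(* written with j = i - 1; parities of (i-1)(m-1) and (n-1)(m-1) are    *)
(* computed as j*(m+1) and (n+1)(m+1) to avoid truncated subtraction.   *)
Section Gerstenhaber.
Variables (P : Type) (k : pzRingType).
Local Notation T := (P -> k).

Definition gcirc (n m : nat) (f g : seq T -> T) (l : seq T) : T :=
  fun q => \sum_(j < n)
    (-1) ^+ (j * m.+1) * f (take j l ++ g (take m (drop j l)) :: drop (j + m) l) q.

Definition gbracket (n m : nat) (f g : seq T -> T) (l : seq T) : T :=
  fun q => gcirc n m f g l q - (-1) ^+ (n.+1 * m.+1) * gcirc m n g f l q.
End Gerstenhaber.

(* Main.v *)
(* A quadratic monomial algebra is Koszul, so a cocycle is cohomologous to one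
   factoring through the projection [proj] of the bar resolution onto chains
   [a1 ... an] of arrows with all [a_i a_(i+1)] in the ideal.  For two such
   representatives [f], [g] the bracket already vanishes on chains.  An interior
   insertion replaces [a_j] by a parallel path which, by (G1), has to be [a_j]
   itself, and this would close an oriented cycle.  In the outer insertions of
   [g] into [f], (G1) forces the value of [g] on [a1 ... am] to be [u a_m], and
   (S3) forces the value of [f] on [a_m ... a_(n+m-1)] to be [a_m v]; the result
   [u a_m v] is the same as for the opposite outer insertion of [f] into [g], and
   the two cancel in the bracket.  A cocycle vanishing on chains is a
   coboundary, and the bracket is well defined on cohomology because the
   Hochschild differential is the bracket with the multiplication. *)
Require Import Defs.
From mathcomp Require Import all_boot all_order all_algebra.
From mathcomp Require Import ring zify.
From Stdlib Require Import FunctionalExtensionality.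
From Stdlib Require List.
Set Implicit Arguments. Unset Strict Implicit. Unset Printing Implicit Defensive.
Import Order.TTheory GRing.Theory Num.Theory.

(** * The pre-Lie structure of insertions *)

(** Cochains are not assumed linear over the vertices, so trivial paths occur as letters of the bar
    words, and both [proj] and its homotopy have to cope with them. The homotopy is not given by a
    formula: moving the first argument into the coefficients turns degree n+1 with values in M into
    degree n with values in Hom(A, M), so a recursion descends in the degree while the bimodule
    grows. This is why the differential and [proj] are treated for all bimodules at once and
    specialised to A only afterwards. Degrees above 1 matter for the interior insertions: a value of
    a cochain on a chain a1 ... an can be cut down to paths parallel to the chain, and if it
    contained the arrow a1 itself, then a2 ... an would be an oriented cycle. For n = 1 there is no
    a2, and a derivation may well rescale a1. That the bracket descends to cohomology is deduced
    from the pre-Lie identity, proved for arbitrary structure constants over a finite basis;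
    admissibility supplies the finite basis. *)

Section Insertion.
Local Open Scope ring_scope.
Variables (k : comNzRingType) (B : finType).
Implicit Types (F : seq B -> k) (f g h : seq B -> B -> k) (l : seq B).

(* Throughout, [p] is the number of arguments of the inserted cochain minus one. *)
Definition insert0 p g F l : k :=
  if (p < size l)%N then \sum_b g (take p.+1 l) b * F (b :: drop p.+1 l) else 0.

(** The factor [(-1) ^+ p] per argument passed accumulates to the Gerstenhaber sign. Since [F] is
    any scalar function of a word, insertions can be nested and a first letter absorbed into [F],
    which the inductions exploit. *)
Fixpoint insert p g F l : k :=
  insert0 p g F l +
  if l is x :: l' then (-1) ^+ p * insert p g (fun w => F (x :: w)) l' else 0.

(** Coordinate [b] of [f] composed with [g]; the inserted cochain comes first here, unlike in
    [brk]. *)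
Definition ins_comp p g f l b : k := insert p g (f^~ b) l.

Definition brk p q f g l b : k :=
  ins_comp q g f l b - (-1) ^+ (p * q) * ins_comp p f g l b.

Lemma insert_cons p g F x l :
  insert p g F (x :: l) =
  insert0 p g F (x :: l) + (-1) ^+ p * insert p g (fun w => F (x :: w)) l.
Proof. by []. Qed.

Lemma eq_insert0 p g g' F F' l :
    (forall w b, size w = p.+1 -> g w b = g' w b) ->
    (forall w, size w = (size l - p)%N -> F w = F' w) ->
  insert0 p g F l = insert0 p g' F' l.
Proof.
move=> eg eF; rewrite /insert0; case: ifP => // lp; apply: eq_bigr => b _.
by rewrite eg ?eF ?size_takel //= size_drop -subSn ?subSS.
Qed.

Lemma insert_small p g F l : (size l <= p)%N -> insert p g F l = 0.
Proof.
elim: l F => [|x l IH] F lp; rewrite /= /insert0 ltnNge lp /= add0r //.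
by rewrite IH ?mulr0 // ltnW.
Qed.

Lemma insert_exact p g F l :
  size l = p.+1 -> insert p g F l = \sum_b g l b * F [:: b].
Proof.
case: l => // x l [sl]; rewrite insert_cons insert_small ?sl // mulr0 addr0.
rewrite /insert0 /= sl ltnS leqnn; apply: eq_bigr => b _.
by rewrite take_oversize ?drop_oversize ?sl.
Qed.

Lemma eq_insert p g g' F F' l :
    (forall w b, size w = p.+1 -> g w b = g' w b) ->
    (forall w, size w = (size l - p)%N -> F w = F' w) ->
  insert p g F l = insert p g' F' l.
Proof.
move=> eg; elim: l F F' => [|x l IH] F F' eF.
  by rewrite !insert_small.
case: (leqP (size (x :: l)) p) => lp; first by rewrite !insert_small.
rewrite /= (eq_insert0 eg eF) (IH _ (fun w => F' (x :: w))) // => w sw.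
by apply: eF; rewrite /= sw subSn.
Qed.

(** This closed form serves to meet the sum over positions in [gcirc]; the inductions use the
    recursion. *)
Lemma insertE p g F l : insert p g F l = \sum_(j < size l - p)
  (-1) ^+ (j * p) * \sum_b g (take p.+1 (drop j l)) b *
    F (take j l ++ b :: drop (j + p.+1) l).
Proof.
elim: l F => [|x l IH] F; first by rewrite insert_small // big_ord0.
rewrite insert_cons IH /insert0; case: (leqP p (size l)) => pl; last first.
  by rewrite ltnNge /= pl (eqP (ltnW pl : (_ <= p)%N)) (eqP (pl : (_ <= p)%N)) !big_ord0 mulr0 addr0.
rewrite ltnS pl /= subSn // big_ord_recl mul1r mulr_sumr /=; congr (_ + _).
by apply: eq_bigr => j _; rewrite mulrA -exprD -mulSn.
Qed.

Lemma insert_linl p g g' c F l :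
  insert p (fun w b => g w b + c * g' w b) F l = insert p g F l + c * insert p g' F l.
Proof.
have E0 G m : insert0 p (fun w b => g w b + c * g' w b) G m =
    insert0 p g G m + c * insert0 p g' G m.
  rewrite /insert0; case: ifP => _; last by ring.
  by rewrite mulr_sumr -big_split /=; apply: eq_bigr => b _; ring.
elim: l F => [|x l IH] F; rewrite /= E0 ?IH; ring.
Qed.

Lemma insert_linr p g F F' c l :
  insert p g (fun w => F w + c * F' w) l = insert p g F l + c * insert p g F' l.
Proof.
have E0 G G' m : insert0 p g (fun w => G w + c * G' w) m =
    insert0 p g G m + c * insert0 p g G' m.
  rewrite /insert0; case: ifP => _; last by ring.
  by rewrite mulr_sumr -big_split /=; apply: eq_bigr => b _; ring.
elim: l F F' => [|x l IH] F F'; rewrite /= E0 ?IH; ring.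
Qed.

Lemma insert_const0 p g l : insert p g (fun=> 0) l = 0.
Proof.
have i0 m : insert0 p g (fun=> 0) m = 0.
  by rewrite /insert0; case: ifP => // _; apply: big1 => b _; rewrite mulr0.
by elim: l => [|x l IH]; rewrite /= i0 ?IH ?mulr0 addr0.
Qed.

Lemma insert_sumr p g (h : B -> k) (F : B -> seq B -> k) l :
  insert p g (fun w => \sum_b h b * F b w) l = \sum_b h b * insert p g (F b) l.
Proof.
have E0 (G : B -> seq B -> k) m : insert0 p g (fun w => \sum_b h b * G b w) m =
    \sum_b h b * insert0 p g (G b) m.
  rewrite /insert0; case: ifP => _; last by rewrite big1 // => b _; rewrite mulr0.
  under eq_bigr do rewrite mulr_sumr.
  rewrite exchange_big; apply: eq_bigr => b _; rewrite mulr_sumr.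
  by apply: eq_bigr => c _; ring.
elim: l F => [|x l IH] F; rewrite /= E0.
  by rewrite addr0; apply: eq_bigr => b _; rewrite addr0.
rewrite IH mulr_sumr -big_split; apply: eq_bigr => b _ /=; ring.
Qed.

(* An insertion of [g] before the leading block [f] either meets [f] or lies
   strictly behind it. *)
Lemma insert_insert0 p q f g F l :
  insert q g (insert0 p f F) l =
  insert0 (p + q) (ins_comp q g f) F l +
  (-1) ^+ (p.+1 * q) *
    (if (p < size l)%N then
       \sum_b f (take p.+1 l) b * insert q g (fun w => F (b :: w)) (drop p.+1 l)
     else 0).
Proof.
elim: p f l => [|p IH] f [|x l].
- by rewrite insert_small // /insert0 /= mulr0 addr0.
- rewrite insert_cons mul1n add0n; congr (_ + _ * _).
  + rewrite /insert0; case: ifP => // ql; rewrite /= take0 drop0.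
    under eq_bigr do rewrite mulr_sumr.
    rewrite exchange_big; apply: eq_bigr => c _.
    rewrite /ins_comp insert_exact /= ?size_takel // mulr_suml.
    by apply: eq_bigr => b _; rewrite mulrA.
  + rewrite /= take0 drop0 -insert_sumr; congr insert.
    by apply: functional_extensionality => w; rewrite /insert0 /= take0 drop0.
- by rewrite insert_small // /insert0 /= mulr0 addr0.
- rewrite insert_cons.
  have E0 w : insert0 p.+1 f F (x :: w) = insert0 p (fun v => f (x :: v)) F w by [].
  rewrite (functional_extensionality _ _ E0) IH.
  rewrite mulrDr mulrA -exprD -mulSn addrA; congr (_ + _).
  have -> : insert0 (p.+1 + q) (ins_comp q g f) F (x :: l) =
      if (p + q < size l)%N then
        \sum_b ins_comp q g f (x :: take (p + q).+1 l) b * F (b :: drop (p + q).+1 l)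
      else 0 by [].
  rewrite /insert0 /= size_drop /= !ltnS ltn_subRL addnC.
  case: (ltnP (p + q) (size l)) => lpq; last first.
    rewrite mulr0 addr0; case: ifP => // _; rewrite big1 // => b _.
    by rewrite mulr0.
  rewrite ifT; last by lia.
  have st : size (take (p + q).+1 l) = (p + q).+1 by rewrite size_takel.
  (* The composite of [f] with [g] on a word starting with [x] splits: either [g] takes in [x], or
     [x] stays the first argument of [f]. *)
  transitivity (\sum_b (\sum_c g (x :: take q l) c * f (c :: take p.+1 (drop q l)) b
      + (-1) ^+ q * ins_comp q g (fun v => f (x :: v)) (take (p + q).+1 l) b)
      * F (b :: drop (p + q).+1 l)).
    under [RHS]eq_bigr do rewrite mulrDl.
    rewrite big_split mulr_sumr /=; congr (_ + _); last first.
      by apply: eq_bigr => b _; rewrite mulrA.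
    under eq_bigr do rewrite mulr_sumr.
    rewrite exchange_big; apply: eq_bigr => b _; rewrite mulr_suml.
    by apply: eq_bigr => c _; rewrite drop_drop addSn mulrA.
  apply: eq_bigr => b _; congr ((_ + _) * _).
  rewrite /insert0 /= st ifT; last by lia.
  by apply: eq_bigr => c _; rewrite take_takel ?take_drop ?addSn //; lia.
Qed.

(** Two successive insertions are either nested or side by side. Each difference leaves the
    side-by-side placements, and these are symmetric in [f] and [g] up to the Koszul sign. *)
Lemma pre_lie p q f g F l :
  insert q g (insert p f F) l - insert (p + q) (ins_comp q g f) F l =
  (-1) ^+ (p * q) *
    (insert p f (insert q g F) l - insert (p + q) (ins_comp p f g) F l).
Proof.
(* [X] collects the placements with [f] at the very front and [g] strictly behind it. *)
pose X p q (f g : seq B -> B -> k) (F : seq B -> k) l : k := if (p < size l)%N then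
  \sum_b f (take p.+1 l) b * insert q g (fun w => F (b :: w)) (drop p.+1 l) else 0.
(* Peeling off one letter leaves the pairs in which [f] or [g] occupies the front; exchanging [f]
   and [g] swaps the two [X] terms. *)
have step p' q' f' g' F' x m :
  insert q' g' (insert p' f' F') (x :: m) -
    insert (p' + q') (ins_comp q' g' f') F' (x :: m) =
  (-1) ^+ (p' + q') * (insert q' g' (insert p' f' (fun w => F' (x :: w))) m -
    insert (p' + q') (ins_comp q' g' f') (fun w => F' (x :: w)) m)
  + (-1) ^+ (p'.+1 * q') * X p' q' f' g' F' (x :: m)
  + (-1) ^+ p' * X q' p' g' f' F' (x :: m).
  have -> : insert q' g' (insert p' f' F') (x :: m) =
      insert q' g' (insert0 p' f' F') (x :: m)
      + (-1) ^+ (p' + q') * insert q' g' (insert p' f' (fun w => F' (x :: w))) m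
      + (-1) ^+ p' * X q' p' g' f' F' (x :: m).
    rewrite [LHS]insert_cons [insert q' g' (insert0 _ _ _) _]insert_cons.
    have -> : insert0 q' g' (insert p' f' F') (x :: m) =
        insert0 q' g' (insert0 p' f' F') (x :: m)
        + (-1) ^+ p' * X q' p' g' f' F' (x :: m).
      rewrite /X /insert0 /= /insert0; case: ifP => _; last by ring.
      rewrite mulr_sumr -big_split; apply: eq_bigr => b _ /=; ring.
    rewrite (functional_extensionality _ _ (fun w => insert_cons p' f' F' x w)).
    rewrite insert_linr exprD; ring.
  rewrite insert_insert0 [insert (p' + q') _ _ (x :: m)]insert_cons -/(X _ _ _ _ _ _).
  ring.
elim: l F => [|x l IH] F; first by rewrite !insert_small //; ring.
rewrite step IH [(p + q)%N]addnC step.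
have e : (-1) ^+ (p * q) * (-1) ^+ (p * q) = 1 :> k by rewrite -expr2 sqrr_sign.
rewrite !mulSn !exprD [(q * p)%N]mulnC; ring: e.
Qed.

(** A graded Jacobi identity from three instances of [pre_lie], with [h], [g] and [mu] in turn as
    outermost cochain; [[g, mu] = 0] removes the third double bracket. With [mu] the multiplication,
    bracketing with a cocycle commutes with the differential up to sign. *)
Lemma brk_cocycle p q h g mu :
    (forall l b, size l = q.+2 -> brk q 1 g mu l b = 0) ->
  forall l b, size l = (p + q).+2 ->
  brk (p + q) 1 (brk p q h g) mu l b =
  (-1) ^+ q * brk p.+1 q (brk p 1 h mu) g l b.
Proof.
move=> cg l b sl.
have brkE p' q' f' g' : brk p' q' f' g' = fun w c =>
    ins_comp q' g' f' w c + (- (-1) ^+ (p' * q')) * ins_comp p' f' g' w c.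
  by do 2![apply: functional_extensionality => ?]; rewrite mulNr.
have linl p' q' r f' g' F : insert r (brk p' q' f' g') F l =
    insert r (ins_comp q' g' f') F l + (- (-1) ^+ (p' * q')) * insert r (ins_comp p' f' g') F l.
  by rewrite brkE insert_linl.
have linr r p' q' f' g' h' : insert r h' ((brk p' q' f' g')^~ b) l =
    insert r h' (insert q' g' (f'^~ b)) l
    + (- (-1) ^+ (p' * q')) * insert r h' (insert p' f' (g'^~ b)) l.
  by rewrite brkE insert_linr.
have cg' w c : size w = q.+2 -> ins_comp 1 mu g w c = (-1) ^+ q * ins_comp q g mu w c.
  by move=> sw; apply/eqP; rewrite -subr_eq0 -(cg w c sw) /brk muln1.
have e1 : insert (q + 1) (ins_comp 1 mu g) (h^~ b) l =
    (-1) ^+ q * insert (q + 1) (ins_comp q g mu) (h^~ b) l.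
  (* [insert_linl] scales only its second summand, so [(-1) ^+ q] times a cochain X is written as X
     plus [(-1) ^+ q - 1] times X. *)
  transitivity (insert (q + 1) (fun w c => ins_comp q g mu w c
      + ((-1) ^+ q - 1) * ins_comp q g mu w c) (h^~ b) l); last first.
    by rewrite insert_linl; ring.
  by apply: eq_insert => // w c; rewrite addn1 => /(cg' w c)->; ring.
have e2 : insert p h (insert 1 mu (g^~ b)) l =
    (-1) ^+ q * insert p h (insert q g (mu^~ b)) l.
  transitivity (insert p h (fun w => insert q g (mu^~ b) w
      + ((-1) ^+ q - 1) * insert q g (mu^~ b) w) l); last first.
    by rewrite insert_linr; ring.
  apply: eq_insert => // w; rewrite sl -addnS -addnS addKn => /(cg' w b).
  by rewrite /ins_comp => ->; ring.
have -> : brk (p + q) 1 (brk p q h g) mu l b =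
    insert 1 mu ((brk p q h g)^~ b) l
    - (-1) ^+ (p + q) * insert (p + q) (brk p q h g) (mu^~ b) l.
  by rewrite {1}/brk muln1.
have -> : brk p.+1 q (brk p 1 h mu) g l b =
    insert q g ((brk p 1 h mu)^~ b) l
    - (-1) ^+ (p.+1 * q) * insert (p + 1) (brk p 1 h mu) (g^~ b) l.
  by rewrite {1}/brk addn1.
rewrite !linr !linl.
have := pre_lie q 1 g mu (h^~ b) l; rewrite e1.
have := pre_lie p 1 h mu (g^~ b) l; rewrite e2.
have := pre_lie p q h g (mu^~ b) l.
have ep : (-1) ^+ p * (-1) ^+ p = 1 :> k by rewrite -expr2 sqrr_sign.
have eq : (-1) ^+ q * (-1) ^+ q = 1 :> k by rewrite -expr2 sqrr_sign.
have epq : (-1) ^+ (p * q) * (-1) ^+ (p * q) = 1 :> k by rewrite -expr2 sqrr_sign.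
rewrite !muln1 mulSn !exprD [(q + 1)%N]addnC.
move=> /(canRL (subrK _)) -> /(canRL (subrK _)) -> /(canRL (subrK _)) ->.
ring: ep eq epq.
Qed.

Lemma brkC p q f g l b : brk q p g f l b = - (-1) ^+ (p * q) * brk p q f g l b.
Proof.
have e : (-1) ^+ (p * q) * (-1) ^+ (p * q) = 1 :> k by rewrite -expr2 sqrr_sign.
rewrite /brk [(q * p)%N]mulnC; ring: e.
Qed.

Lemma brkDl p q f f' g l b :
  brk p q (fun w c => f w c + f' w c) g l b = brk p q f g l b + brk p q f' g l b.
Proof.
rewrite /brk /ins_comp.
have := insert_linr q g (f^~ b) (f'^~ b) 1 l; have := insert_linl p f f' 1 (g^~ b) l.
rewrite !mul1r.
rewrite (_ : (fun w c => f w c + 1 * f' w c) = fun w c => f w c + f' w c); last first.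
  by do 2![apply: functional_extensionality => ?]; rewrite mul1r.
rewrite (_ : (fun w => f w b + 1 * f' w b) = fun w => f w b + f' w b); last first.
  by apply: functional_extensionality => ?; rewrite mul1r.
move=> -> ->; ring.
Qed.

Lemma eq_brk p q f f' g g' l b :
    (forall w c, size w = p.+1 -> f w c = f' w c) ->
    (forall w c, size w = q.+1 -> g w c = g' w c) -> size l = (p + q).+1 ->
  brk p q f g l b = brk p q f' g' l b.
Proof.
move=> ef eg sl; rewrite /brk /ins_comp.
congr (_ - _ * _); apply: eq_insert => // w sw.
  by apply: ef; rewrite sw sl; lia.
by apply: eg; rewrite sw sl; lia.
Qed.

Lemma brk0l p q g l b : brk p q (fun _ _ => 0) g l b = 0.
Proof.
have := brkDl p q (fun _ _ => 0) (fun _ _ => 0) g l b.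
rewrite (_ : (fun _ _ => 0 + 0) = fun _ _ => 0); last first.
  by do 2![apply: functional_extensionality => ?]; rewrite addr0.
by move/eqP; rewrite -subr_eq subrr eq_sym => /eqP.
Qed.

End Insertion.

(** * Bimodules, the Koszul projection and its homotopy *)

Section Paths.
Local Open Scope ring_scope.
Variables (V E : finType) (s t : E -> V) (Rel : rel E) (N : nat).
Hypothesis bounded : forall p : seq E, size p = N -> consec s t p -> in_ideal Rel p.

Hypothesis rel_path : relations_are_paths s t Rel.

Local Notation valid := (valid s t Rel).
Arguments Defs.valid : simpl never.

Definition nonzero a b := (t a == s b) && ~~ Rel a b.

(** The ideal is generated by paths of length 2, so lying outside it is a condition on consecutive
    arrows. *)
Lemma valid_cons v a p : valid (v, a :: p) = (s a == v) && path nonzero a p.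
Proof.
have path_nonzero : path nonzero a p =
    path (fun x y => t x == s y) a p && ~~ in_ideal Rel (a :: p).
  rewrite /in_ideal /=; elim: p a => //= b p IH a; rewrite {}IH /nonzero negb_or.
  by case: (t a == s b); case: (Rel a b); rewrite ?andbF.
rewrite /Defs.valid /= path_nonzero /consec /=.
by case: (path _ _ _); case: (s a == v).
Qed.

Lemma valid_nil v : valid (v, [::]).
Proof. by []. Qed.

Lemma valid1 a : valid (s a, [:: a]).
Proof. by rewrite valid_cons eqxx. Qed.

Lemma endv_cat v p q : endv t v (p ++ q) = endv t (endv t v p) q.
Proof. by case: p => // a p; case: q => [|b q] /=; rewrite ?cats0 ?last_cat. Qed.

Lemma endv_rcons v p a : endv t v (rcons p a) = t a.
Proof. by case: p => //= b p; rewrite last_rcons. Qed.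

Lemma valid_cat v p q :
  valid (v, p ++ q) -> valid (v, p) && valid (endv t v p, q).
Proof.
case: p => [|a p] /=; first by move=> ->.
rewrite !valid_cons cat_path => /and3P[-> -> ] /=.
by case: q => //= b q /andP[/andP[/eqP tb _] pq]; rewrite valid_cons tb eqxx.
Qed.

Lemma valid_rcons_cons v p a b q :
  valid (v, rcons p a) -> valid (t a, b :: q) ->
  valid (v, rcons p a ++ b :: q) = ~~ Rel a b.
Proof.
case: p => [|c p] /=; rewrite !valid_cons.
  by move=> /andP[-> _] /andP[/eqP sb pq]; rewrite /= /nonzero sb eqxx pq andbT.
rewrite cat_path last_rcons /= => /andP[-> ->] /andP[/eqP sb ->].
by rewrite /nonzero sb eqxx andbT.
Qed.

Lemma valid_size q : valid q -> (size q.2 < N)%N.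
Proof.
case: q => v p vp; rewrite ltnNge; apply/negP => /= Np.
move: vp; rewrite -(cat_take_drop N p) => /valid_cat /andP[].
rewrite /Defs.valid /= => /and3P[c _ /negP ni] _; apply: ni.
by apply: bounded; rewrite // size_takel.
Qed.

(** Admissibility bounds the length of valid paths by [N], so this finite enumeration misses none of
    them and [basis] can be a [finType]. *)
Definition paths : seq (pkey V E) :=
  [seq q <- [seq (v, bseqval p) | v <- enum V, p <- enum {bseq N of E}] | valid q].

Lemma mem_paths q : (q \in paths) = valid q.
Proof.
rewrite mem_filter andbC; case vq: (valid q); rewrite ?andbF // andbT.
case: q vq => v p /valid_size/ltnW sp.
by apply/allpairsP; exists (v, Bseq sp); rewrite !mem_enum.
Qed.

Definition basis : finType := seq_sub paths.

Definition src (x : basis) : V := (ssval x).1.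
Definition arr (x : basis) : seq E := (ssval x).2.
Definition tgt (x : basis) : V := endv t (src x) (arr x).
Definition key q : option basis := insub q.

Lemma basis_valid x : valid (src x, arr x).
Proof. by rewrite -mem_paths -surjective_pairing (ssvalP x). Qed.

Lemma basis_eq x y : src x = src y -> arr x = arr y -> x = y.
Proof.
move=> e1 e2; apply: val_inj => /=.
by rewrite (surjective_pairing (ssval x)) (surjective_pairing (ssval y)); congr pair.
Qed.

Lemma key_basis x : key (src x, arr x) = Some x.
Proof. by rewrite /key -surjective_pairing valK. Qed.

Lemma key_valid q : valid q -> exists x, [/\ key q = Some x, src x = q.1 & arr x = q.2].
Proof.
move=> vq; have qP : q \in paths by rewrite mem_paths.
by exists (SeqSub qP); split=> //; rewrite /key insubT.
Qed.

Lemma key_None q : valid q = false -> key q = None.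
Proof. by move=> vq; rewrite /key insubF // mem_paths. Qed.

Lemma key_Some q x : key q = Some x <-> src x = q.1 /\ arr x = q.2.
Proof.
split=> [|[]]; last by move: q => [v p] /= <- <-; rewrite key_basis.
case vq: (valid q); last by rewrite key_None.
by have [y [-> sy ay]] := key_valid vq => -[<-].
Qed.

Definition arrow a : basis := SeqSub (etrans (mem_paths _) (valid1 a)).
Definition idem v : basis := SeqSub (etrans (mem_paths _) (valid_nil v)).

Definition pmul (x y : basis) : option basis :=
  if tgt x == src y then key (src x, arr x ++ arr y) else None.

Lemma pmul_Some x y z :
  pmul x y = Some z <-> [/\ tgt x = src y, src z = src x & arr z = arr x ++ arr y].
Proof.
rewrite /pmul; case: eqP => [e|ne]; last by split=> // -[].
by rewrite key_Some /=; split=> -[].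
Qed.

Lemma key_catNl v p q : key (v, p) = None -> key (v, p ++ q) = None.
Proof.
case vpq: (valid (v, p ++ q)); last by rewrite (key_None vpq).
by have /andP[/key_valid[x [->]]] := valid_cat vpq.
Qed.

Lemma key_catNr v p q : key (endv t v p, q) = None -> key (v, p ++ q) = None.
Proof.
case vpq: (valid (v, p ++ q)); last by rewrite (key_None vpq).
by have /andP[_ /key_valid[x [->]]] := valid_cat vpq.
Qed.

(** Both sides are the concatenation of the three words when the end points match; an invalid factor
    makes the whole concatenation invalid, so a vanishing partial product loses nothing. *)
Lemma pmulA x y z : obind (pmul x) (pmul y z) = obind (pmul^~ z) (pmul x y).
Proof.
transitivity (if (tgt x == src y) && (tgt y == src z)
              then key (src x, arr x ++ arr y ++ arr z) else None).
  rewrite [pmul y z]/pmul; case: eqP => [yz|_]; last by rewrite andbF.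
  case k: (key _) => [u|] /=; rewrite andbT.
    by have [/= su au] := (key_Some _ _).1 k; rewrite /pmul su au.
  by case: eqP => // xy; rewrite key_catNr // -/(tgt x) xy.
rewrite [pmul x y]/pmul; case: eqP => [xy|//] /=.
case k: (key (_, arr x ++ arr y)) => [u|] /=; last by case: ifP => // _; rewrite catA (key_catNl _ k).
have [/= su au] := (key_Some _ _).1 k.
by rewrite /pmul /tgt su au endv_cat -/(tgt x) xy -/(tgt y) catA.
Qed.

Lemma pmul_idem x v : pmul x (idem v) = if tgt x == v then Some x else None.
Proof.
rewrite /pmul -[src (idem v)]/v -[arr (idem v)]/[::].
by case: eqP => // _; rewrite cats0 key_basis.
Qed.

Lemma idem_pmul v x : pmul (idem v) x = if v == src x then Some x else None.
Proof.
rewrite /pmul -[tgt (idem v)]/v -[src (idem v)]/v -[arr (idem v)]/[::].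
by case: eqP => // ->; rewrite key_basis.
Qed.

(** Basis paths act on a bare additive group, so that functions from [basis] to a bimodule form a
    bimodule again. [lact1] and [ract1] say that the unit, the sum of the trivial paths, acts as the
    identity. *)
Record bimodule := Bimodule {
  car :> zmodType;
  lact : basis -> car -> car;
  ract : car -> basis -> car;
  lactB : forall x, {morph lact x : m n / m - n};
  ractB : forall x, {morph ract^~ x : m n / m - n};
  lactA : forall x y m, lact x (lact y m) = oapp (lact^~ m) 0 (pmul x y);
  ractA : forall x y m, ract (ract m x) y = oapp (ract m) 0 (pmul x y);
  lract : forall x y m, lact x (ract m y) = ract (lact x m) y;
  lact1 : forall m, \sum_v lact (idem v) m = m;
  ract1 : forall m, \sum_v ract m (idem v) = m }.

Arguments lact {b} x m.
Arguments ract {b} m x.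

Section BimoduleTheory.
Variable M : bimodule.
Implicit Types (m : M) (x y : basis).

Lemma lact0 x : lact x (0 : M) = 0.
Proof. by rewrite -{1}(subrr 0) lactB subrr. Qed.
Lemma ract0 x : ract (0 : M) x = 0.
Proof. by rewrite -{1}(subrr 0) (ractB x) subrr. Qed.
Lemma lactN x m : lact x (- m) = - lact x m.
Proof. by rewrite -sub0r lactB lact0 sub0r. Qed.
Lemma ractN x m : ract (- m) x = - ract m x.
Proof. by rewrite -sub0r (ractB x) ract0 sub0r. Qed.
Lemma lactD x : {morph lact x : m n / (m : M) + n}.
Proof. by move=> m n; rewrite -[n]opprK lactB lactN !opprK. Qed.
Lemma ractD x : {morph (@ract M)^~ x : m n / m + n}.
Proof. by move=> m n; rewrite -[n]opprK (ractB x) ractN !opprK. Qed.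
Lemma lact_sum x (I : Type) (r : seq I) (P : pred I) (F : I -> M) :
  lact x (\sum_(i <- r | P i) F i) = \sum_(i <- r | P i) lact x (F i).
Proof. exact: (big_morph _ (lactD x) (lact0 x)). Qed.
Lemma ract_sum x (I : Type) (r : seq I) (P : pred I) (F : I -> M) :
  ract (\sum_(i <- r | P i) F i) x = \sum_(i <- r | P i) ract (F i) x.
Proof. exact: (big_morph _ (ractD x) (ract0 x)). Qed.

(** Action of an arbitrary arrow word, zero if it is not a basis path. Words can then be
    concatenated ([lkeyM], [rkeyM]) without deciding whether the result lies in the ideal. *)
Definition lkey q m : M := oapp (lact^~ m) 0 (key q).
Definition rkey m q : M := oapp (ract m) 0 (key q).

Lemma lkey_basis x m : lkey (src x, arr x) m = lact x m.
Proof. by rewrite /lkey key_basis. Qed.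
Lemma rkey_basis x m : rkey m (src x, arr x) = ract m x.
Proof. by rewrite /rkey key_basis. Qed.
Lemma lkey0 q : lkey q 0 = 0.
Proof. by rewrite /lkey; case: key => //= x; rewrite lact0. Qed.
Lemma rkey0 q : rkey 0 q = 0.
Proof. by rewrite /rkey; case: key => //= x; rewrite ract0. Qed.
Lemma lkeyB q : {morph lkey q : m n / m - n}.
Proof. by move=> m n; rewrite /lkey; case: key => [x|] /=; rewrite ?lactB ?subr0. Qed.
Lemma rkeyB q : {morph rkey^~ q : m n / m - n}.
Proof. by move=> m n; rewrite /rkey; case: key => [x|] /=; rewrite ?(ractB x) ?subr0. Qed.
Lemma rkeyN q m : rkey (- m) q = - rkey m q.
Proof. by rewrite -sub0r rkeyB rkey0 sub0r. Qed.
Lemma lkeyD q : {morph lkey q : m n / m + n}.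
Proof. by move=> m n; rewrite /lkey; case: key => [x|] /=; rewrite ?lactD ?addr0. Qed.
Lemma rkeyD q : {morph rkey^~ q : m n / m + n}.
Proof. by move=> m n; rewrite /rkey; case: key => [x|] /=; rewrite ?(ractD x) ?addr0. Qed.
Lemma lkey_None q m : key q = None -> lkey q m = 0.
Proof. by rewrite /lkey => ->. Qed.
Lemma rkey_None q m : key q = None -> rkey m q = 0.
Proof. by rewrite /rkey => ->. Qed.
Lemma lrkey p q m : lkey p (rkey m q) = rkey (lkey p m) q.
Proof.
rewrite /lkey /rkey; case: (key p) (key q) => [x|] [y|] //=.
- exact: lract.
- by rewrite lact0.
- by rewrite ract0.
Qed.

Lemma lkeyM v p w q m :
  lkey (v, p) (lkey (w, q) m) = if endv t v p == w then lkey (v, p ++ q) m else 0.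
Proof.
rewrite /lkey; case kp: (key (v, p)) => [x|] /=; last first.
  by rewrite (key_catNl _ kp) if_same.
have [/= sx ax] := (key_Some _ _).1 kp; rewrite -sx -ax -/(tgt x).
case kq: (key (w, q)) => [y|] /=; last first.
  by rewrite lact0; case: eqP => // e; rewrite key_catNr // -/(tgt x) e.
have [/= sy ay] := (key_Some _ _).1 kq; rewrite lactA /pmul sy ay.
by case: eqP.
Qed.

Lemma rkeyM v p w q m :
  rkey (rkey m (v, p)) (w, q) = if endv t v p == w then rkey m (v, p ++ q) else 0.
Proof.
rewrite /rkey; case kp: (key (v, p)) => [x|] /=; last first.
  by rewrite (key_catNl _ kp) if_same; case: key => //= y; rewrite ract0.
have [/= sx ax] := (key_Some _ _).1 kp; rewrite -sx -ax -/(tgt x).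
case kq: (key (w, q)) => [y|] /=; last first.
  by case: eqP => // e; rewrite key_catNr // -/(tgt x) e.
have [/= sy ay] := (key_Some _ _).1 kq; rewrite ractA /pmul sy ay.
by case: eqP.
Qed.

End BimoduleTheory.

(** * The Hochschild differential on basis words, and [proj] as a cochain map *)

Section Hochschild.
Variable M : bimodule.
Implicit Types (f g : seq basis -> M) (w : seq basis) (x y : basis).

Definition fmul f x y w : M := oapp (fun z => f (z :: w)) 0 (pmul x y).

(* All terms of [-hd f w] except the one with a left action. *)
Fixpoint bar f w : M :=
  if w is x :: w' then
    if w' is y :: w'' then fmul f x y w'' - bar (fun v => f (x :: v)) w'
    else ract (f [::]) x
  else 0.

Definition hd f w : M := if w is x :: w' then lact x (f w') - bar f w else 0.

Lemma bar_cons f x y w :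
  bar f [:: x, y & w] = fmul f x y w - bar (fun v => f (x :: v)) (y :: w).
Proof. by []. Qed.

Lemma barB f g w : bar (fun v => f v - g v) w = bar f w - bar g w.
Proof.
elim: w f g => [|x [|y w] IH] f g; first by rewrite /= subr0.
  by rewrite /= (ractB x).
rewrite !bar_cons IH !opprD !opprK [RHS]addrACA; congr (_ + _).
by rewrite /fmul; case: pmul => [z|] /=; rewrite ?subr0.
Qed.

Lemma hdB f g w : hd (fun v => f v - g v) w = hd f w - hd g w.
Proof.
case: w => [|x w]; first by rewrite /= subr0.
by rewrite /hd barB lactB !opprD !opprK [RHS]addrACA.
Qed.

Lemma eq_bar f g w :
  (forall v, (size v).+1 = size w -> f v = g v) -> bar f w = bar g w.
Proof.
elim: w f g => [|x [|y w] IH] f g fg //; first by rewrite /= fg.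
rewrite !bar_cons (IH _ (fun v => g (x :: v))) => [|v sv]; last by apply: fg; case: sv => /= ->.
by congr (_ - _); rewrite /fmul; case: pmul => //= z; rewrite fg.
Qed.

Lemma eq_hd f g w :
  (forall v, (size v).+1 = size w -> f v = g v) -> hd f w = hd g w.
Proof. by case: w => // x w fg; rewrite /hd fg // (eq_bar fg). Qed.

(** [a] is the last arrow of the chain read so far. Every further letter must begin with an arrow
    [b] such that [a b] is a relation; only the final letter may be longer, and its remainder [p]
    passes to the right action. *)
Fixpoint tail_proj a f w : M :=
  if w is y :: w' then
    if arr y is b :: p then
      if Rel a b then
        if w' is [::] then rkey (f [:: arrow b]) (t b, p)
        else if p is [::] then tail_proj b (fun v => f (arrow b :: v)) w' else 0
      else 0
    else 0
  else 0.

Lemma tail_proj_cons a f y w : tail_proj a f (y :: w) =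
  if arr y is b :: p then
    if Rel a b then
      if w is [::] then rkey (f [:: arrow b]) (t b, p)
      else if p is [::] then tail_proj b (fun v => f (arrow b :: v)) w else 0
    else 0
  else 0.
Proof. by []. Qed.
Arguments tail_proj : simpl never.

Definition head_proj f v p w : M :=
  if p is a :: q then
    let b := last a q in
    lkey (v, belast a q) (tail_proj b (fun u => f (arrow b :: u)) w)
  else 0.

Fixpoint der f v p : M :=
  if p is a :: q then
    lkey (v, [::]) (rkey (f [:: arrow a]) (t a, q)) + lkey (v, [:: a]) (der f (t a) q)
  else 0.

(* Precomposition with the composite bar -> Koszul -> bar of comparison maps:
   [f(w1, ..., wn)] becomes [u f(a1, ..., an) v] if [w1 = u a1], [wi = ai] for
   [1 < i < n], [wn = an v] and every [a_i a_(i+1)] is a relation, and [0]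
   otherwise. In degree 1 it is the derivation [der f] determined by the arrows.
   The trivial paths [u] and [v] matter: cochains need not be linear over the
   vertices. *)
Definition proj f w : M :=
  match w with
  | [::] => \sum_v lact (idem v) (ract (f [::]) (idem v))
  | [:: x] => der f (src x) (arr x)
  | x :: w' => head_proj f (src x) (arr x) w'
  end.

Lemma tail_projB a f g w :
  tail_proj a (fun v => f v - g v) w = tail_proj a f w - tail_proj a g w.
Proof.
elim: w a f g => [|y w IH] a f g; first by rewrite /tail_proj subr0.
rewrite !tail_proj_cons; case: (arr y) => [|b p]; first by rewrite subr0.
case: ifP => _; last by rewrite subr0.
case: w IH => [|z w] IH; first by rewrite rkeyB.
by case: p => [|c p]; rewrite ?IH ?subr0.
Qed.

Lemma derB f g v p : der (fun w => f w - g w) v p = der f v p - der g v p.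
Proof.
elim: p v => [|a p IH] v /=; first by rewrite subr0.
by rewrite rkeyB !lkeyB IH lkeyB opprD addrACA.
Qed.

Lemma head_projB f g v p w :
  head_proj (fun u => f u - g u) v p w = head_proj f v p w - head_proj g v p w.
Proof. by case: p => [|a p] /=; rewrite ?subr0 // tail_projB lkeyB. Qed.

Lemma projB f g w : proj (fun v => f v - g v) w = proj f w - proj g w.
Proof.
case: w => [|x [|y w]]; [|exact: derB|exact: head_projB].
by rewrite /= -sumrB; apply: eq_bigr => v _; rewrite ractB lactB.
Qed.

Lemma eq_tail_proj a f g w :
    (forall b v, Rel a b -> (size v).+1 = size w -> f (arrow b :: v) = g (arrow b :: v)) ->
  tail_proj a f w = tail_proj a g w.
Proof.
elim: w a f g => [|y w IH] a f g fg //.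
rewrite !tail_proj_cons; case: (arr y) => [|b p] //; case: ifP => // ab.
case: w IH fg => [|z w] IH fg; first by rewrite fg.
by case: p => // ; apply: IH => c v bc sv; apply: fg; rewrite //= sv.
Qed.

Lemma eq_proj f g w :
  (forall v, size v = size w -> f v = g v) -> proj f w = proj g w.
Proof.
case: w => [|x [|y w]] fg /=.
- by rewrite fg.
- by elim: (arr x) (src x) => //= a p IH v; rewrite fg ?IH.
- rewrite /head_proj; case: (arr x) => //= a p; congr lkey; apply: eq_tail_proj.
  by move=> b v _ sv; apply: fg; rewrite /= sv.
Qed.

Lemma tail_proj_lact x a f w :
  tail_proj a (fun v => lact x (f v)) w = lact x (tail_proj a f w).
Proof.
have lx q m : lact x (rkey m q) = rkey (lact x m) q.
  by rewrite -lkey_basis lrkey lkey_basis.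
elim: w a f => [|y w IH] a f; first by rewrite /tail_proj lact0.
rewrite !tail_proj_cons; case: (arr y) => [|b p]; first by rewrite lact0.
case: ifP => _; last by rewrite lact0.
case: w IH => [|z w] IH; first by rewrite lx.
by case: p => [|c p]; rewrite ?IH ?lact0.
Qed.

Lemma tail_projN a f w : tail_proj a (fun v => - f v) w = - tail_proj a f w.
Proof.
rewrite -[RHS]sub0r -(subrr (tail_proj a f w)) -!tail_projB.
by apply: eq_tail_proj => b v _ _; rewrite subrr sub0r.
Qed.

Lemma fmul_key f x y w : tgt x = src y ->
  fmul f x y w = oapp (fun z => f (z :: w)) 0 (key (src x, arr x ++ arr y)).
Proof. by rewrite /fmul /pmul => ->; rewrite eqxx. Qed.

Lemma fmul_neq f x y w : tgt x != src y -> fmul f x y w = 0.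
Proof. by rewrite /fmul /pmul => /negPf->. Qed.

Lemma fmul_arrow f a b w : Rel a b -> fmul f (arrow a) (arrow b) w = 0.
Proof.
move=> ab; rewrite /fmul; case k: pmul => [z|] //=.
have [_ sz az] := (pmul_Some _ _ _).1 k.
have := basis_valid z; rewrite sz az -[arr _ ++ _]/[:: a; b] valid_cons.
by rewrite /= /nonzero ab !andbF.
Qed.

Lemma arr_cons x a p : arr x = a :: p -> src x = s a.
Proof. by move=> ax; have := basis_valid x; rewrite ax valid_cons => /andP[/eqP]. Qed.

Lemma arr_nonzero x u a b v : arr x = u ++ [:: a, b & v] -> nonzero a b.
Proof.
move=> ax; have := basis_valid x; rewrite ax => /valid_cat/andP[_].
by rewrite valid_cons => /= /and3P[].
Qed.

Lemma tail_proj_src a f y w : src y != t a -> tail_proj a f (y :: w) = 0.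
Proof.
rewrite tail_proj_cons; case ay: (arr y) => [|b p] //; case: ifP => // ab.
by rewrite (arr_cons ay) (rel_path ab) eqxx.
Qed.

Lemma fmul_nil f x y w : arr x = [::] ->
  fmul f x y w = if src x == src y then f (y :: w) else 0.
Proof.
move=> ax; rewrite /fmul /pmul /tgt ax /=.
by case: eqP => // ->; rewrite key_basis.
Qed.

Lemma fmul_nilr f x y w : arr y = [::] ->
  fmul f x y w = if tgt x == src y then f (x :: w) else 0.
Proof.
move=> ay; rewrite /fmul /pmul ay cats0 key_basis; case: eqP => //.
Qed.

Lemma fmul0 f x y w :
  (forall z, arr z = arr x ++ arr y -> f (z :: w) = 0) -> fmul f x y w = 0.
Proof.
move=> f0; rewrite /fmul; case k: pmul => [z|] //=.
by have [_ _ az] := (pmul_Some _ _ _).1 k; apply: f0.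
Qed.

Lemma bar0 f w : (forall v, (size v).+1 = size w -> f v = 0) -> bar f w = 0.
Proof.
move=> f0; rewrite (@eq_bar f (fun v => f v - f v)) => [|v /f0->]; last by rewrite subr0.
by rewrite barB subrr.
Qed.

Lemma tgt_cons x a p : arr x = a :: p -> tgt x = endv t (t a) p.
Proof. by rewrite /tgt => ->; case: p. Qed.

Lemma key_rel v p a b q : Rel a b -> key (v, rcons p a ++ b :: q) = None.
Proof.
move=> ab; case vk: (valid (v, rcons p a ++ b :: q)); last exact: key_None.
have := valid_cat vk; rewrite endv_rcons => /andP[vp vq].
by have := vk; rewrite valid_rcons_cons // ab.
Qed.

Lemma ract_rkey (m : M) y : ract m y = rkey m (src y, arr y).
Proof. by rewrite rkey_basis. Qed.

(** For nontrivial [y] the merge with [z] cancels the right action of [z], unless [y] is a single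
    arrow [b] and [z] starts with [c] where [b c] is a relation. Then the merge is zero and the
    right action alone survives, on both sides. *)
Lemma bar_tail_proj2 a f y z :
  bar (tail_proj a f) [:: y; z] =
  tail_proj a (bar f) [:: y; z] +
  (if (arr y == [::]) && (src y == t a) then tail_proj a f [:: z] else 0).
Proof.
have -> : bar (tail_proj a f) [:: y; z] =
  fmul (tail_proj a f) y z [::] - ract (tail_proj a f [:: y]) z by [].
rewrite (tail_proj_cons a f y) (tail_proj_cons a (bar f) y); case ay: (arr y) => [|b p].
  rewrite ract0 subr0 fmul_nil //= add0r.
  case: (eqVneq (src z) (t a)) => [->|ne]; first by [].
  by rewrite tail_proj_src // !if_same.
rewrite /= addr0; case ab: (Rel a b); last first.
  rewrite ract0 subr0 fmul0 // => u.
  by rewrite ay tail_proj_cons /= => ->; rewrite ab.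
rewrite ract_rkey rkeyM -(tgt_cons ay).
have [yz|yz] := eqVneq (tgt y) (src z); last first.
  rewrite fmul_neq // subr0; case: p ay => [|//] ay.
  by rewrite tail_proj_src //; move: yz; rewrite (tgt_cons ay) /= eq_sym.
rewrite fmul_key //.
have vy := basis_valid y; have vz := basis_valid z.
case: p ay => [|c p] ay; last first.
  case k: (key _) => [u|] /=.
    by rewrite tail_proj_cons ((key_Some _ _).1 k).2 /= ay /= ab subrr.
  have kN : key (t b, (c :: p) ++ arr z) = None.
    case vp: (valid (t b, (c :: p) ++ arr z)); last exact: key_None.
    have : valid (src y, arr y ++ arr z).
      move: vp vy; rewrite ay /= !valid_cons /= => /andP[_ ->].
      by rewrite andbT => /and3P[-> ->].
    by case/key_valid=> u []; rewrite k.
  by rewrite /rkey kN subrr.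
have tb : t b = src z by rewrite -yz (tgt_cons ay).
case az: (arr z) => [|c r]; rewrite tail_proj_cons az.
  by rewrite cats0 key_basis /= tail_proj_cons ay ab subrr.
rewrite ay; case bc: (Rel b c).
  rewrite (@key_rel _ [::]) // fmul_arrow // !sub0r /= rkeyN ract_rkey.
  by rewrite rkeyM eqxx tb (arr_cons az).
have : valid (src y, rcons [::] b ++ c :: r).
  by rewrite valid_rcons_cons ?bc // /= -?ay // tb -az.
case/key_valid=> u [-> _ au] /=.
by rewrite tail_proj_cons au /= ab subrr.
Qed.

(* The correction term is the price of unit letters, which the Koszul
   words avoid but the unnormalised bar words contain. *)
Lemma bar_tail_proj a f y z w :
  bar (tail_proj a f) (y :: z :: w) =
  tail_proj a (bar f) (y :: z :: w) +
  (if (arr y == [::]) && (src y == t a) then tail_proj a f (z :: w) else 0).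
Proof.
elim: w a f y z => [|z' w IH] a f y z; first exact: bar_tail_proj2.
have -> : bar (tail_proj a f) [:: y, z, z' & w] =
  fmul (tail_proj a f) y z (z' :: w)
  - bar (fun v => tail_proj a f (y :: v)) [:: z, z' & w] by [].
case ay: (arr y) => [|b p].
  rewrite bar0 => [|v _]; last by rewrite tail_proj_cons ay.
  rewrite subr0 fmul_nil // [tail_proj a (bar f) _]tail_proj_cons ay add0r /=.
  case: (eqVneq (src z) (t a)) => [->|ne]; first by [].
  by rewrite tail_proj_src // !if_same.
rewrite addr0.
case ab: (Rel a b); last first.
  rewrite fmul0 => [|u]; last by rewrite ay tail_proj_cons /= => ->; rewrite ab.
  by rewrite bar0 => [|v _]; rewrite tail_proj_cons ay ab ?subrr.
case: p ay => [|c p] ay; last first.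
  rewrite fmul0 => [|u]; last by rewrite ay tail_proj_cons /= => ->; rewrite ab.
  by rewrite bar0 => [|[|v0 v] // _]; rewrite tail_proj_cons ay ab ?subrr.
rewrite (@eq_bar _ (tail_proj b (fun v => f (arrow b :: v)))); last first.
  by case=> [|v0 v] // _; rewrite tail_proj_cons ay ab.
rewrite IH [tail_proj a (bar f) _]tail_proj_cons ay ab.
case az: (arr z) => [|c r].
  rewrite !(tail_proj_cons b _ z) az add0r fmul_nilr //= tail_proj_cons ay ab.
  by rewrite (tgt_cons ay) /= eq_sym; case: eqP => _; rewrite /= ?ay ?ab ?subrr.
rewrite fmul0 => [|u]; last by rewrite ay az tail_proj_cons /= => ->; rewrite ab.
rewrite sub0r addr0 -tail_projN; apply: eq_tail_proj => c' v bc _.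
by rewrite [RHS]bar_cons fmul_arrow // sub0r.
Qed.

Lemma bar_lkey q f w : bar (fun v => lkey q (f v)) w = lkey q (bar f w).
Proof.
elim: w f => [|x [|y w] IH] f; first by rewrite /= lkey0.
  by rewrite /= !ract_rkey lrkey.
rewrite !bar_cons IH lkeyB; congr (_ - _).
by rewrite /fmul; case: pmul => //=; rewrite lkey0.
Qed.

Lemma head_proj_rcons f v p a w :
  head_proj f v (rcons p a) w =
  lkey (v, p) (tail_proj a (fun u => f (arrow a :: u)) w).
Proof. by case: p => //= b p; rewrite last_rcons belast_rcons. Qed.

Lemma lact_lkey x v p m : tgt x = v ->
  lact x (lkey (v, p) m) = lkey (src x, arr x ++ p) m :> M.
Proof. by move=> <-; rewrite -lkey_basis lkeyM eqxx. Qed.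

Lemma proj_nil f :
  proj f [::] = \sum_v lkey (v, [::]) (rkey (f [::]) (v, [::])).
Proof.
apply: eq_bigr => v _; rewrite -[(v, [::])]/(src (idem v), arr (idem v)).
by rewrite lkey_basis rkey_basis.
Qed.

(** On an arrow, [hd f] is the commutator with [f [::]]; along a path the inner terms telescope. *)
Lemma der_hd f v p : valid (v, p) -> der (hd f) v p =
  lkey (v, p) (rkey (f [::]) (endv t v p, [::])) - lkey (v, [::]) (rkey (f [::]) (v, p)).
Proof.
elim: p v => [|a p IH] v vp; first by rewrite /= subrr.
move: vp; rewrite -[a :: p]/([:: a] ++ p) => vp.
have /andP[va pa] := valid_cat vp; move: va; rewrite valid_cons => /andP[/eqP sa _].
have -> : der (hd f) v ([:: a] ++ p) =
    lkey (v, [::]) (rkey (lact (arrow a) (f [::]) - ract (f [::]) (arrow a)) (t a, p))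
    + lkey (v, [:: a]) (der (hd f) (t a) p) by [].
rewrite (IH _ pa) endv_cat -[endv t v [:: a]]/(t a) rkeyB ract_rkey rkeyM eqxx.
rewrite -[src (arrow a)]/(s a) sa -lkey_basis -[(src (arrow a), _)]/(s a, [:: a]) sa.
rewrite -lrkey !lkeyB !lkeyM !eqxx cats0.
by rewrite addrC addrA addrNK.
Qed.

Lemma hd_proj0 f x : hd (proj f) [:: x] = proj (hd f) [:: x].
Proof.
rewrite [RHS]der_hd ?basis_valid // -[LHS]/(lact x (proj f [::]) - ract (proj f [::]) x).
rewrite proj_nil lact_sum ract_sum; congr (_ - _).
  rewrite -/(tgt x) (bigD1 (tgt x)) //= big1 => [|v /negPf tv].
    by rewrite addr0 lact_lkey // cats0.
  by rewrite -lkey_basis lkeyM eq_sym tv.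
rewrite (bigD1 (src x)) //= big1 => [|v /negPf sv].
  by rewrite addr0 ract_rkey -lrkey rkeyM eqxx.
by rewrite ract_rkey -lrkey rkeyM sv lkey0.
Qed.

Lemma lkey_der f v p (v' : V) q :
  endv t v p != v' -> lkey (v, p) (der f v' q) = 0.
Proof.
case: q => [|a q] /= /negPf vw; first by rewrite lkey0.
by rewrite lkeyD !lkeyM vw addr0.
Qed.

Lemma rkey_der f v p (v' : V) q :
  endv t v p != v' -> rkey (der f v p) (v', q) = 0.
Proof.
elim: p v => [|a p IH] v vw /=; first by rewrite rkey0.
have tw : endv t (t a) p != v' by case: (p) vw.
by rewrite rkeyD -!lrkey rkeyM (negPf tw) IH // !lkey0 addr0.
Qed.

(** Leibniz rule for all arrow words, including those in the ideal. There [der] need not vanish, and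
    its value is the obstruction identified in [hd_proj1]. *)
Lemma der_cat f v p q : der f v (p ++ q) =
  rkey (der f v p) (endv t v p, q) + lkey (v, p) (der f (endv t v p) q).
Proof.
elim: p v => [|a p IH] v /=.
  rewrite rkey0 add0r; case: q => [|a q] /=; first by rewrite lkey0.
  by rewrite lkeyD !lkeyM /= eqxx.
have -> : t (last a p) = endv t (t a) p by case: (p).
rewrite IH rkeyD -!lrkey rkeyM eqxx lkeyD addrA; congr (_ + _).
by rewrite lkeyM /= eqxx.
Qed.

Lemma nil_or_rcons (p : seq E) : p = [::] \/ exists q a, p = rcons q a.
Proof. by case: (lastP p) => [|q a]; [left | right; exists q, a]. Qed.

(** By the Leibniz rule the left side is [der f] of the concatenated word minus its value at the
    product. These differ only if the concatenation lies in the ideal, and then the relation sits at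
    the junction [a c]. *)
Lemma hd_proj1 f x y : hd (proj f) [:: x; y] = proj (hd f) [:: x; y].
Proof.
have -> : hd (proj f) [:: x; y] = lact x (der f (src y) (arr y)) -
   (fmul (proj f) x y [::] - ract (der f (src x) (arr x)) y) by [].
have -> : proj (hd f) [:: x; y] = head_proj (hd f) (src x) (arr x) [:: y] by [].
rewrite ract_rkey -lkey_basis.
have [xy|xy] := eqVneq (tgt x) (src y); last first.
  rewrite lkey_der // rkey_der // fmul_neq // subr0 subrr.
  have [ax|[p [a ax]]] := nil_or_rcons (arr x); rewrite ax //.
  rewrite head_proj_rcons tail_proj_src ?lkey0 //.
  by move: xy; rewrite /tgt ax endv_rcons eq_sym.
rewrite fmul_key // opprB addrA [lkey _ _ + _]addrC.
have := der_cat f (src x) (arr x) (arr y); rewrite -/(tgt x) xy => <-.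
have vx := basis_valid x; have vy := basis_valid y.
case k: (key _) => [u|] /=.
  rewrite ((key_Some _ _).1 k).1 ((key_Some _ _).1 k).2 /= subrr.
  have [ax|[p [a ax]]] := nil_or_rcons (arr x); rewrite ax //.
  rewrite head_proj_rcons tail_proj_cons.
  case ay: (arr y) => [|c q]; first by rewrite lkey0.
  case ac: (Rel a c); last by rewrite lkey0.
  by move: k; rewrite ax ay key_rel.
rewrite subr0.
have [ax|[p [a ax]]] := nil_or_rcons (arr x).
  by move: k; rewrite ax (_ : src x = src y) ?key_basis // -xy /tgt ax.
case ay: (arr y) => [|c q]; first by move: k; rewrite ay cats0 key_basis.
have vx' : valid (src x, rcons p a) by rewrite -ax.
have vy' : valid (t a, c :: q) by rewrite -ay (_ : t a = src y) // -xy /tgt ax endv_rcons.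
have ac : Rel a c.
  apply/negPn/negP => nac; have := valid_rcons_cons vx' vy'; rewrite nac.
  by case/key_valid=> u []; rewrite -ax -ay k.
have sa : endv t (src x) p = s a.
  by move: vx'; rewrite -cats1 => /valid_cat/andP[_]; rewrite valid_cons => /andP[/eqP].
have tc := rel_path ac.
rewrite ax der_cat endv_rcons -{1}cats1 der_cat head_proj_rcons tail_proj_cons ay ac.
rewrite [der f _ [:: a]]/= [der f (t a) (c :: q)]/= lkey0 addr0.
(* Terms differentiating an arrow other than this [a] or [c] keep the factor [a c] and vanish. *)
have kr : key (s a, [:: a] ++ c :: q) = None by exact: (@key_rel _ [::]).
have kl : key (src x, rcons p a ++ [:: c]) = None by exact: key_rel.
rewrite rkeyD -lrkey sa rkeyM eqxx (rkey_None _ kr) add0r.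
rewrite -lrkey rkeyM eqxx lkeyM sa eqxx cats0.
rewrite lkeyD !lkeyM endv_rcons eqxx cats0 (lkey_None _ kl) addr0 addrC.
have -> : hd f [:: arrow a; arrow c] =
    lkey (s a, [:: a]) (f [:: arrow c]) + rkey (f [:: arrow a]) (s c, [:: c]).
  rewrite -[(s a, _)]/(src (arrow a), arr (arrow a)).
  rewrite -[(s c, _)]/(src (arrow c), arr (arrow c)) lkey_basis rkey_basis.
  by rewrite /= fmul_arrow // sub0r opprK.
by rewrite rkeyD -lrkey rkeyM eqxx lkeyD lkeyM sa eqxx cats1 tc.
Qed.

Lemma head_proj_cat f v p b q w :
  head_proj f v (p ++ b :: q) w =
  lkey (v, p ++ belast b q)
    (tail_proj (last b q) (fun u => f (arrow (last b q) :: u)) w).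
Proof. by rewrite lastI -rcons_cat head_proj_rcons. Qed.

Lemma lact_head_proj0 f x v p w : tgt x != v -> lact x (head_proj f v p w) = 0.
Proof.
move=> /negPf xv; case: p => [|a p] /=; first by rewrite lact0.
by rewrite -lkey_basis lkeyM -/(tgt x) xv.
Qed.

(** Let [x] end in [a] and let [y = c q]. If [a c] is not a relation, the left action of [x] cancels
    the merge of [x] with [y]. If it is, the merge is zero; for nonempty [q] all other terms vanish
    too, and for [y = c] the left action together with [bar_tail_proj] gives [hd f] on the chain. *)
Lemma hd_proj2 f x y z w : hd (proj f) [:: x, y, z & w] = proj (hd f) [:: x, y, z & w].
Proof.
have -> : hd (proj f) [:: x, y, z & w] = lact x (head_proj f (src y) (arr y) (z :: w))
    - (fmul (proj f) x y (z :: w)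
       - bar (fun v => head_proj f (src x) (arr x) v) [:: y, z & w]).
  transitivity (lact x (proj f [:: y, z & w]) - (fmul (proj f) x y (z :: w)
    - bar (fun v => proj f (x :: v)) [:: y, z & w])); first by [].
  by congr (_ - (_ - _)); apply: eq_bar => -[|v0 v].
have -> : proj (hd f) [:: x, y, z & w] =
   head_proj (hd f) (src x) (arr x) [:: y, z & w] by [].
have [ax|[p [a ax]]] := nil_or_rcons (arr x).
  rewrite ax bar0 // subr0 fmul_nil //.
  rewrite -[proj f _]/(head_proj f (src y) (arr y) (z :: w)).
  have tx : tgt x = src x by rewrite /tgt ax.
  have [xy|xy] := eqVneq (src x) (src y); last by rewrite lact_head_proj0 ?tx // subrr.
  case: (arr y) => [|c q]; first by rewrite /= lact0 subrr.
  by rewrite /= lact_lkey ?tx // ax xy subrr.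
rewrite ax head_proj_rcons.
rewrite (@eq_bar _ (fun v => lkey (src x, p) (tail_proj a (fun u => f (arrow a :: u)) v)));
  last by move=> v _; rewrite head_proj_rcons.
rewrite bar_lkey bar_tail_proj.
have tx : tgt x = t a by rewrite /tgt ax endv_rcons.
case ay: (arr y) => [|c q].
  rewrite !(tail_proj_cons a _ y) ay /= lact0 add0r lkey0 fmul_nilr //.
  rewrite -[proj f _]/(head_proj f (src x) (arr x) (z :: w)) ax head_proj_rcons.
  by rewrite add0r tx eq_sym; case: eqP => _; rewrite ?lkey0 subrr oppr0.
rewrite addr0.
have [xy|xy] := eqVneq (tgt x) (src y); last first.
  rewrite lact_head_proj0 // fmul_neq // !tail_proj_src; try by rewrite eq_sym -tx.
  by rewrite lkey0 !subr0.
have vx := basis_valid x; have vy := basis_valid y.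
rewrite fmul_key // ax ay [head_proj f _ (c :: q) _]/= lact_lkey // ax.
rewrite !(tail_proj_cons a _ y) ay.
case ac: (Rel a c); last first.
  have : valid (src x, rcons p a ++ c :: q).
    by rewrite valid_rcons_cons ?ac -?ax // -tx xy -ay.
  case/key_valid=> u [-> /= su au]; rewrite lkey0 subr0 su au.
  by rewrite head_proj_cat subrr.
rewrite key_rel //= sub0r opprK.
case: q ay => [|d q] ay; last first.
  by rewrite !lkey0 addr0; apply/lkey_None/(key_rel _ _ _ ac).
rewrite [RHS](_ : _ = lkey (src x, p) (tail_proj c
    (fun v => lact (arrow a) (f (arrow c :: v))
       - (- bar (fun u => f (arrow a :: u)) (arrow c :: v))) (z :: w))); last first.
  congr lkey; apply: eq_tail_proj => d v cd _.
  by rewrite [LHS]/= fmul_arrow // sub0r.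
rewrite tail_projB tail_projN opprK tail_proj_lact lkeyD; congr (_ + _).
have sa : endv t (src x) p = s a.
  by move: vx; rewrite ax -cats1 => /valid_cat/andP[_]; rewrite valid_cons => /andP[/eqP].
rewrite -[lact _ _]lkey_basis -[(src (arrow a), _)]/(s a, [:: a]) lkeyM sa eqxx.
by rewrite cats0 cats1.
Qed.

(** [proj] changes shape between degrees 0 and 1 and between degrees 1 and 2, so words of length 1
    and 2 are separate cases; from length 3 on only chains occur. *)
Lemma hd_proj f w : hd (proj f) w = proj (hd f) w.
Proof.
case: w => [|x [|y [|z w]]].
- by rewrite /= big1 // => v _; rewrite ract0 lact0.
- exact: hd_proj0.
- exact: hd_proj1.
- exact: hd_proj2.
Qed.

End Hochschild.
Arguments tail_proj {M} a f w : simpl never.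

(** * Coefficients in Hom(A, M), and the homotopy between the identity and [proj] *)

Section HomBimodule.
Variable M : bimodule.
Implicit Types (phi psi : {ffun basis -> M}) (x y z : basis).

Definition hom_lact y phi : {ffun basis -> M} := [ffun x => oapp phi 0 (pmul x y)].
Definition hom_ract phi y : {ffun basis -> M} := [ffun x => ract (phi x) y].

Lemma hom_lactB y : {morph hom_lact y : phi psi / phi - psi}.
Proof.
by move=> phi psi; apply/ffunP => x; rewrite !ffunE; case: pmul => [z|] /=; rewrite ?subr0 ?ffunE.
Qed.

Lemma hom_ractB y : {morph hom_ract^~ y : phi psi / phi - psi}.
Proof. by move=> phi psi; apply/ffunP => x; rewrite !ffunE (ractB y). Qed.

Lemma hom_lactA x y phi :
  hom_lact x (hom_lact y phi) = oapp (hom_lact^~ phi) 0 (pmul x y).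
Proof.
apply/ffunP => z; rewrite ffunE; have := pmulA z x y.
case: (pmul z x) => [u|] /=; case: (pmul x y) => [v|] /= e; rewrite !ffunE //= ?e //.
by rewrite -e.
Qed.

Lemma hom_ractA x y phi :
  hom_ract (hom_ract phi x) y = oapp (hom_ract phi) 0 (pmul x y).
Proof.
by apply/ffunP => z; rewrite !ffunE ractA; case: pmul => [u|] /=; rewrite ffunE.
Qed.

Lemma hom_lract x y phi : hom_lact x (hom_ract phi y) = hom_ract (hom_lact x phi) y.
Proof.
by apply/ffunP => z; rewrite !ffunE; case: pmul => [u|] /=; rewrite ?ffunE ?ract0.
Qed.

Lemma hom_lact1 phi : \sum_v hom_lact (idem v) phi = phi.
Proof.
apply/ffunP => x; rewrite sum_ffunE (bigD1 (tgt x)) //= big1 => [|v vx].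
  by rewrite ffunE pmul_idem eqxx addr0.
by rewrite ffunE pmul_idem eq_sym (negPf vx).
Qed.

Lemma hom_ract1 phi : \sum_v hom_ract phi (idem v) = phi.
Proof.
by apply/ffunP => x; rewrite sum_ffunE -[RHS]ract1; apply: eq_bigr => v _; rewrite ffunE.
Qed.

(* [Hom_k(A, M)] with [(a phi)(x) = phi(x a)] and [(phi a)(x) = phi(x) a]:
   moving the first argument of a cochain into the coefficients. *)
Definition hom_bimodule : bimodule :=
  Bimodule hom_lactB hom_ractB hom_lactA hom_ractA hom_lract hom_lact1 hom_ract1.

Definition shift (f : seq basis -> M) w : hom_bimodule := [ffun x => f (x :: w)].

Definition iota (m : M) : hom_bimodule := [ffun x => lact x m].

(** Evaluation at the unit of A: a left inverse of [iota], additive but in general not compatible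
    with the left actions. *)
Definition eval1 (phi : hom_bimodule) : M := \sum_v phi (idem v).

Lemma eval1_iota m : eval1 (iota m) = m.
Proof. by rewrite -[RHS]lact1; apply: eq_bigr => v _; rewrite ffunE. Qed.

Lemma eval1B : {morph eval1 : phi psi / phi - psi}.
Proof. by move=> phi psi; rewrite -sumrB; apply: eq_bigr => v _; rewrite !ffunE. Qed.

End HomBimodule.

Record bimodule_map (M M' : bimodule) (phi : M -> M') : Prop := BimoduleMap {
  mapB : {morph phi : m n / m - n};
  map_lact : forall x m, phi (lact x m) = lact x (phi m);
  map_ract : forall x m, phi (ract m x) = ract (phi m) x }.

Lemma iota_map M : bimodule_map (@iota M).
Proof.
split=> [m n|x m|x m]; apply/ffunP => y; rewrite !ffunE ?lactB //.
- by rewrite lactA; case: pmul => //= z; rewrite ffunE.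
- by rewrite lract.
Qed.

(** Compatibility with the right action suffices, so the lemma applies to the evaluation of
    [hom_bimodule] at a basis path in [hd_shift]. *)
Lemma bar_morph (M M' : bimodule) (phi : M -> M') f w :
    {morph phi : m n / m - n} -> (forall x m, phi (ract m x) = ract (phi m) x) ->
  bar (fun v => phi (f v)) w = phi (bar f w).
Proof.
move=> phiB phiR; have phi0 : phi 0 = 0 by rewrite -{1}(subrr 0) phiB subrr.
elim: w f => [|x [|y w] IH] f //; first by rewrite /= phiR.
rewrite !bar_cons IH phiB; congr (_ - _).
by rewrite /fmul; case: pmul.
Qed.

Lemma map_hom_map (M M' : bimodule) (phi : M -> M') : bimodule_map phi ->
  bimodule_map (fun psi : hom_bimodule M => [ffun x => phi (psi x)] : hom_bimodule M').
Proof.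
case=> phiB phiL phiR; have phi0 : phi 0 = 0 by rewrite -{1}(subrr 0) phiB subrr.
split=> [m n|x m|x m]; apply/ffunP => y; rewrite !ffunE ?phiB ?phiR //.
by case: pmul => //= z; rewrite ffunE.
Qed.

Section Naturality.
Variables (M M' : bimodule) (phi : M -> M').
Hypothesis phi_map : bimodule_map phi.
Implicit Types (f : seq basis -> M).

Lemma map0 : phi 0 = 0.
Proof. by rewrite -{1}(subrr 0) (mapB phi_map) subrr. Qed.

Lemma mapD : {morph phi : m n / m + n}.
Proof.
move=> m n; rewrite -[n in LHS]opprK (mapB phi_map).
by rewrite -[- n]sub0r (mapB phi_map) map0 sub0r opprK.
Qed.

Lemma map_sum (I : finType) (F : I -> M) : phi (\sum_i F i) = \sum_i phi (F i).
Proof. exact: (big_morph _ mapD map0). Qed.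

Lemma map_lkey q m : phi (lkey q m) = lkey q (phi m).
Proof. by rewrite /lkey; case: key => //= [x|]; rewrite ?(map_lact phi_map) ?map0. Qed.

Lemma map_rkey q m : phi (rkey m q) = rkey (phi m) q.
Proof. by rewrite /rkey; case: key => //= [x|]; rewrite ?(map_ract phi_map) ?map0. Qed.

Lemma hd_morph f w : hd (fun v => phi (f v)) w = phi (hd f w).
Proof.
case: w => [|x w]; first by rewrite map0.
rewrite /hd (mapB phi_map) (map_lact phi_map) bar_morph //.
- exact: mapB.
- exact: map_ract.
Qed.

Lemma tail_proj_morph a f w :
  tail_proj a (fun v => phi (f v)) w = phi (tail_proj a f w).
Proof.
elim: w a f => [|y w IH] a f; first by rewrite /tail_proj map0.
rewrite !tail_proj_cons; case: (arr y) => [|b p]; first by rewrite map0.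
case: ifP => _; last by rewrite map0.
case: w IH => [|z w] IH; first by rewrite map_rkey.
by case: p => [|c p]; rewrite ?IH ?map0.
Qed.

Lemma proj_morph f w : proj (fun v => phi (f v)) w = phi (proj f w).
Proof.
case: w => [|x [|y w]] /=.
- rewrite map_sum; apply: eq_bigr => v _.
  by rewrite (map_lact phi_map) (map_ract phi_map).
- elim: (arr x) (src x) => [|a p IH] v /=; first by rewrite map0.
  by rewrite mapD !map_lkey map_rkey IH.
- case: (arr x) => [|a p] /=; first by rewrite map0.
  rewrite map_lkey; congr lkey.
  exact: (tail_proj_morph _ (fun u => f (arrow _ :: u))).
Qed.

End Naturality.

(* The homotopy between the identity and [proj] built recursively, as in the
   comparison theorem for projective resolutions, from the contraction
   [x [w] y |-> 1 [x | w] y] of the bar resolution, whose transpose is [shift]. *)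
Fixpoint htpy n (M : bimodule) (f : seq basis -> M) w : M :=
  eval1 (shift f w - proj (shift f) w
    - (if n is n'.+1 then hd (@htpy n' (hom_bimodule M) (shift f)) w else 0)).

Lemma hd0 (M : bimodule) w : hd (fun=> 0 : M) w = 0.
Proof.
rewrite -[RHS](subrr (hd (fun=> 0 : M) w)) -hdB.
by apply: eq_hd => v _; rewrite subrr.
Qed.

Lemma shiftE (M : bimodule) (f : seq basis -> M) x w : shift f w x = f (x :: w).
Proof. by rewrite ffunE. Qed.

Lemma hom_sub (M : bimodule) (phi psi : hom_bimodule M) x :
  (phi - psi) x = phi x - psi x.
Proof. by rewrite !ffunE. Qed.

(** The left action on [hom_bimodule] is made for this: the merge of [x] with [y] becomes the left
    action of [y] on the coefficients. *)
Lemma hd_shift (M : bimodule) (f : seq basis -> M) x y w :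
  hd f [:: x, y & w] = lact x (f (y :: w)) - hd (shift f) (y :: w) x.
Proof.
rewrite [LHS]/hd bar_cons [X in _ = _ - X]hom_sub ffunE; congr (_ - (_ - _)).
  by rewrite /fmul; case: pmul => //= z; rewrite shiftE.
pose ev (phi : hom_bimodule M) := phi x.
rewrite -[RHS]/(ev _) -bar_morph => [|m n|z m]; rewrite /ev ?hom_sub ?ffunE //.
by apply: eq_bar => v _; rewrite shiftE.
Qed.

Lemma shift_hd (M : bimodule) (f : seq basis -> M) w : w <> [::] ->
  shift (hd f) w = iota (f w) - hd (shift f) w.
Proof.
by case: w => // y w _; apply/ffunP => x; rewrite shiftE hom_sub hd_shift !ffunE.
Qed.

(** Induction over all bimodules: [shift_hd] reduces the claim to Hom(A, M) on a shorter word, and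
    the [iota] terms cancel because [iota] is a bimodule map. *)
Lemma hd_hd (M : bimodule) (f : seq basis -> M) w : hd (hd f) w = 0.
Proof.
elim: w M f => [|x [|y [|z w]] IH] M f //.
- by rewrite /= lact0 ract0 subrr.
- rewrite -[LHS]/(lact x (lact y (f [::]) - ract (f [::]) y) - (fmul (hd f) x y [::]
    - ract (lact x (f [::]) - ract (f [::]) x) y)).
  rewrite lactB (ractB y) lactA ractA lract /fmul opprB addrACA.
  case: pmul => [z|] /=.
    by apply/eqP; rewrite addr_eq0 !opprD !opprK addrCA.
  by rewrite !subr0 add0r subrr.
rewrite hd_shift (@eq_hd _ (shift (hd f)) (fun v => iota (f v) - hd (shift f) v)).
  by rewrite hdB IH subr0 hd_morph ?ffunE ?subrr //; exact: iota_map.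
by case=> // v0 v _; apply: shift_hd.
Qed.

Lemma eq_htpy n (M : bimodule) (f g : seq basis -> M) w :
    (forall v, size v = n.+1 -> f v = g v) -> size w = n ->
  htpy n f w = htpy n g w.
Proof.
elim: n M f g w => [|n IH] M f g w fg sw /=.
  rewrite (@eq_proj _ (shift f) (shift g)) => [|v sv].
    by congr (eval1 (_ - _ - _)); apply/ffunP => x; rewrite !shiftE fg //= sw.
  by apply/ffunP => x; rewrite !shiftE fg //= sv sw.
have sfg v : size v = n.+1 -> shift f v = shift g v.
  by move=> sv; apply/ffunP => x; rewrite !shiftE fg //= sv.
rewrite (@eq_proj _ (shift f) (shift g)) => [|v]; last by rewrite sw; apply: sfg.
rewrite sfg // (@eq_hd _ (htpy n (shift f)) (htpy n (shift g))) // => v.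
by rewrite sw => -[sv]; apply: IH.
Qed.

Lemma htpyB n (M : bimodule) (f g : seq basis -> M) w :
  htpy n (fun v => f v - g v) w = htpy n f w - htpy n g w.
Proof.
have sB (N' : bimodule) (f' g' : seq basis -> N') :
    shift (fun v => f' v - g' v) = fun v => shift f' v - shift g' v.
  by apply: functional_extensionality => v; apply/ffunP => x; rewrite hom_sub !shiftE.
elim: n M f g w => [|n IH] M f g w /=; rewrite sB projB -eval1B.
  by congr eval1; rewrite !subr0 !opprD !opprK addrACA.
rewrite (functional_extensionality _ _ (IH _ _ _)) hdB.
by congr eval1; rewrite !opprD !opprK [RHS]addrACA; congr (_ + _); rewrite addrACA.
Qed.

(** Naturality in the coefficients, used for [iota] in [htpyP]; the recursion changes the bimodule,
    so the induction runs over all maps at once. *)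
Lemma htpy_morph n (M M' : bimodule) (phi : M -> M') f w : bimodule_map phi ->
  htpy n (fun v => phi (f v)) w = phi (htpy n f w).
Proof.
have sE (N1 N2 : bimodule) (ps : N1 -> N2) (g : seq basis -> N1) :
    shift (fun v => ps (g v)) =
    fun v => [ffun x => ps (shift g v x)] : hom_bimodule N2.
  by apply: functional_extensionality => v; apply/ffunP => x; rewrite !ffunE.
have evE (N1 N2 : bimodule) (ps : N1 -> N2) (xi : hom_bimodule N1) : bimodule_map ps ->
    eval1 ([ffun x => ps (xi x)] : hom_bimodule N2) = ps (eval1 xi).
  by move=> psP; rewrite /eval1 (map_sum psP); apply: eq_bigr => v _; rewrite ffunE.
elim: n M M' phi f w => [|n IH] M M' phi f w phi_map /=;
  have phi'_map := map_hom_map phi_map; rewrite sE (proj_morph phi'_map).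
  by rewrite -evE // !subr0 (mapB phi'_map).
rewrite (functional_extensionality _ _ (fun v => IH _ _ _ (shift f) v phi'_map)).
by rewrite (hd_morph phi'_map) -evE // !(mapB phi'_map).
Qed.

(** In the inductive step each piece of [htpy n.+1 (hd f)] splits into an [iota] part, from which
    [eval1] recovers the wanted term, and a part under [hd]; the latter parts cancel. *)
Lemma htpyP n (M : bimodule) (f : seq basis -> M) w : size w = n ->
  f w - proj f w =
  htpy n (hd f) w + (if n is n'.+1 then hd (htpy n' f) w else 0).
Proof.
elim: n M f w => [|n IH] M f w sw.
  case: w sw => // _; rewrite addr0 /= subr0 eval1B.
  have -> : eval1 (shift (hd f) [::]) = 0.
    rewrite /eval1; under eq_bigr do rewrite shiftE -[hd _ _]/(lact _ _ - ract _ _).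
    by rewrite sumrB lact1 ract1 subrr.
  rewrite sub0r -opprB; congr (- _).
  have -> : \sum_v (lact (idem v) (ract (f [::]) (idem v))) - f [::] =
    \sum_v (lact (idem v) (ract (f [::]) (idem v)) - ract (f [::]) (idem v)).
    by rewrite sumrB ract1.
  apply: eq_bigr => v _; rewrite sum_ffunE (bigD1 v) //= big1 => [|u /negPf uv].
    rewrite addr0 ffunE pmul_idem eqxx /= ffunE shiftE /= (ractB (idem v)) lract.
    by rewrite ractA pmul_idem eqxx.
  by rewrite ffunE pmul_idem eq_sym uv.
(* On words of length [n] the induction hypothesis identifies [K] with [htpy n (hd (shift f))]; the
   last term of [K] dies under [hd] by [hd_hd]. *)
pose K v := shift f v - proj (shift f) v
    - (if n is n'.+1 then hd (@htpy n' (hom_bimodule M) (shift f)) v else 0).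
have KE v : size v = n -> htpy n (hd (shift f)) v = K v.
  by move=> sv; rewrite /K IH // addrK.
have w0 : w <> [::] by case: (w) sw.
have hK : hd K w = hd (shift f) w - hd (proj (shift f)) w.
  rewrite /K hdB hdB; case: (n) => [|n']; last by rewrite hd_hd subr0.
  by rewrite hd0 subr0.
have hs : shift (hd f) w = iota (f w) - hd (shift f) w by exact: shift_hd.
have ps : proj (shift (hd f)) w = iota (proj f w) - hd (proj (shift f)) w.
  rewrite (@eq_proj _ _ (fun v => iota (f v) - hd (shift f) v)).
    by rewrite projB -hd_proj proj_morph //; exact: iota_map.
  by move=> v sv; apply: shift_hd => v0; move: sv; rewrite v0 sw.
have hh : hd (htpy n (shift (hd f))) w = iota (hd (htpy n f) w) - hd K w.
  rewrite -(hd_morph (iota_map M)) -hdB; apply: eq_hd => v.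
  rewrite sw => -[sv]; rewrite -KE // -(htpy_morph _ _ _ (iota_map M)) -htpyB.
  by apply: eq_htpy => // u su; apply: shift_hd; case: (u) su.
rewrite [htpy _ _ _]/= hs ps hh hK.
rewrite !eval1B !eval1_iota; set h := eval1 (hd _ w); set p := eval1 (hd _ w).
symmetry; rewrite [- (hd _ _ - _)]opprB -addrA addrNK [- (_ - p)]opprB.
by rewrite addrAC !addrA !addrNK.
Qed.

Lemma htpy0 n (M : bimodule) w : size w = n -> htpy n (fun=> 0 : M) w = 0.
Proof.
move=> sw; rewrite -[RHS](subrr (htpy n (fun=> 0 : M) w)) -htpyB.
by apply: eq_htpy => // v _; rewrite subrr.
Qed.

Lemma cocycle_htpy n (M : bimodule) (f : seq basis -> M) w :
    (forall v, size v = n.+2 -> hd f v = 0) -> size w = n.+1 ->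
  f w = proj f w + hd (htpy n f) w.
Proof.
move=> cf sw; apply/eqP; rewrite -subr_eq0 opprD addrA subr_eq0; apply/eqP.
rewrite (htpyP f sw) (@eq_htpy _ _ (hd f) (fun=> 0)) ?htpy0 ?add0r //.
Qed.

(** * A as a bimodule over itself, and the bracket on its cochains *)

Section Algebra.
Variable k : comNzRingType.
Implicit Types (phi psi : {ffun basis -> k}) (x y z b : basis).

Definition alg_lact x phi : {ffun basis -> k} :=
  [ffun b => \sum_y (pmul x y == Some b)%:R * phi y].
Definition alg_ract phi x : {ffun basis -> k} :=
  [ffun b => \sum_y (pmul y x == Some b)%:R * phi y].

Lemma sum_Some (o : option basis) (F : basis -> k) :
  \sum_b (o == Some b)%:R * F b = oapp F 0 o.
Proof.
case: o => [z|] /=; last by rewrite big1 // => b _; rewrite mul0r.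
rewrite (bigD1 z) //= eqxx mul1r big1 ?addr0 // => b bz.
by rewrite (inj_eq Some_inj) eq_sym (negPf bz) mul0r.
Qed.

Lemma sum_obind (o : basis -> option basis) (h : basis -> option basis) phi b :
  \sum_y (h y == Some b)%:R * (\sum_z (o z == Some y)%:R * phi z) =
  \sum_z (obind h (o z) == Some b)%:R * phi z.
Proof.
under eq_bigr do rewrite mulr_sumr.
rewrite exchange_big; apply: eq_bigr => z _ /=.
rewrite (eq_bigr (fun y => (o z == Some y)%:R * ((h y == Some b)%:R * phi z))).
  by rewrite sum_Some; case: (o z) => //=; rewrite mul0r.
by move=> y _; ring.
Qed.

Lemma alg_lactB x : {morph alg_lact x : phi psi / phi - psi}.
Proof.
move=> phi psi; apply/ffunP => b; rewrite !ffunE -sumrB.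
by apply: eq_bigr => y _; rewrite !ffunE mulrBr.
Qed.

Lemma alg_ractB x : {morph alg_ract^~ x : phi psi / phi - psi}.
Proof.
move=> phi psi; apply/ffunP => b; rewrite !ffunE -sumrB.
by apply: eq_bigr => y _; rewrite !ffunE mulrBr.
Qed.

Lemma alg_lactA x y phi :
  alg_lact x (alg_lact y phi) = oapp (alg_lact^~ phi) 0 (pmul x y).
Proof.
apply/ffunP => b; rewrite ffunE; under eq_bigr do rewrite ffunE.
rewrite sum_obind; under eq_bigr do rewrite pmulA.
case: pmul => [z|] /=; rewrite ffunE //.
by rewrite big1 // => z _; rewrite mul0r.
Qed.

Lemma alg_ractA x y phi :
  alg_ract (alg_ract phi x) y = oapp (alg_ract phi) 0 (pmul x y).
Proof.
apply/ffunP => b; rewrite ffunE; under eq_bigr do rewrite ffunE.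
rewrite (sum_obind (pmul^~ x) (pmul^~ y)); under eq_bigr do rewrite -pmulA.
case: pmul => [z|] /=; rewrite ffunE //.
by rewrite big1 // => z _; rewrite mul0r.
Qed.

Lemma alg_lract x y phi : alg_lact x (alg_ract phi y) = alg_ract (alg_lact x phi) y.
Proof.
apply/ffunP => b; rewrite !ffunE; under eq_bigr do rewrite ffunE.
rewrite (sum_obind (pmul^~ y) (pmul x)).
under [RHS]eq_bigr do rewrite ffunE.
rewrite (sum_obind (pmul x) (pmul^~ y)).
by apply: eq_bigr => z _; rewrite pmulA.
Qed.

Lemma alg_lact1 phi : \sum_v alg_lact (idem v) phi = phi.
Proof.
apply/ffunP => b; rewrite sum_ffunE (bigD1 (src b)) //= big1 => [|v vb].
  rewrite addr0 ffunE (bigD1 b) //= idem_pmul !eqxx mul1r big1 ?addr0 // => y yb.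
  by rewrite idem_pmul; case: ifP; rewrite ?(inj_eq Some_inj) ?(negPf yb) mul0r.
rewrite ffunE big1 // => y _; rewrite idem_pmul.
case: (v =P src y) => [vy|_]; last by rewrite mul0r.
by case: (Some y =P Some b) => [[yb]|_]; rewrite ?mul0r //; case/eqP: vb; rewrite -yb.
Qed.

Lemma alg_ract1 phi : \sum_v alg_ract phi (idem v) = phi.
Proof.
apply/ffunP => b; rewrite sum_ffunE (bigD1 (tgt b)) //= big1 => [|v vb].
  rewrite addr0 ffunE (bigD1 b) //= pmul_idem !eqxx mul1r big1 ?addr0 // => y yb.
  by rewrite pmul_idem; case: ifP; rewrite ?(inj_eq Some_inj) ?(negPf yb) mul0r.
rewrite ffunE big1 // => y _; rewrite pmul_idem.
case: (tgt y =P v) => [yv|_]; last by rewrite mul0r.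
by case: (Some y =P Some b) => [[yb]|_]; rewrite ?mul0r //; case/eqP: vb; rewrite -yb.
Qed.

Definition alg : bimodule :=
  Bimodule alg_lactB alg_ractB alg_lactA alg_ractA alg_lract alg_lact1 alg_ract1.

Definition coef (f : seq basis -> alg) (w : seq basis) (b : basis) : k := f w b.

Definition mult (w : seq basis) (b : basis) : k :=
  if w is [:: x; y] then (pmul x y == Some b)%:R else 0.

Implicit Types (f g h : seq basis -> alg) (w : seq basis).

Lemma alg_sub (phi psi : alg) b : (phi - psi) b = phi b - psi b.
Proof. by rewrite !ffunE. Qed.

Lemma bar_insert f x w b :
  bar f (x :: w) b =
  insert 1 mult (fun v => f v b) (x :: w)
  + (-1) ^+ size w * ract (f (belast x w)) (last x w) b.
Proof.
elim: w f x => [|y w IH] f x; first by rewrite insert_small // add0r mul1r.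
rewrite bar_cons alg_sub IH [insert 1 _ _ [:: x, y & w]]insert_cons expr1.
have -> : insert0 1 mult (fun v => f v b) [:: x, y & w] = fmul f x y w b.
  rewrite /insert0 /= take0 drop0 /fmul -/(tgt _).
  rewrite (sum_Some (pmul x y) (fun z => f (z :: w) b)).
  by case: pmul => //=; rewrite ffunE.
rewrite exprS; set A := insert _ _ _ _.
by rewrite -[last x _]/(last y w) -[belast x _]/(x :: belast y w); ring.
Qed.

(** The inner terms of the differential insert the multiplication into [f]; the two outer ones
    insert [f] into the multiplication. *)
Lemma hd_brk p f w b : size w = p.+2 -> hd f w b = - brk p 1 (coef f) mult w b.
Proof.
case: w => // x w [sw]; rewrite alg_sub bar_insert sw /brk /ins_comp muln1.
rewrite [insert p _ _ _]insert_cons [insert p _ _ w]insert_exact //.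
have -> : insert0 p (coef f) (mult^~ b) (x :: w) = ract (f (belast x w)) (last x w) b.
  rewrite ffunE /insert0 ifT; last by rewrite /= sw ltnS.
  rewrite lastI -cats1.
  have sb : size (belast x w) = p.+1 by rewrite size_belast.
  apply: eq_bigr => y _; rewrite take_size_cat // drop_size_cat //= mulrC.
  by [].
have -> : \sum_b0 coef f w b0 * mult [:: x; b0] b = lact x (f w) b.
  by rewrite ffunE; apply: eq_bigr => y _; rewrite mulrC.
have e : (-1) ^+ p * (-1) ^+ p = 1 :> k by rewrite -expr2 sqrr_sign.
rewrite exprS /coef; ring: e.
Qed.

Definition scale (c : k) (m : alg) : alg := [ffun b => c * m b].

Lemma scale_map c : bimodule_map (scale c).
Proof.
split=> [m n|x m|x m]; apply/ffunP => b; rewrite !ffunE ?mulrBr // mulr_sumr.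
  by apply: eq_bigr => y _; rewrite ffunE; ring.
by apply: eq_bigr => y _; rewrite ffunE; ring.
Qed.

Definition bracket p q f g (w : seq basis) : alg :=
  [ffun b => brk p q (coef f) (coef g) w b].

(** Cochains are functions on words of every length, so the degree enters as the length of the words
    on which equality is required. *)
Definition exact_on n f := exists h, forall w, size w = n -> f w = hd h w.

Lemma exact_scale n c f : exact_on n f -> exact_on n (fun w => scale c (f w)).
Proof.
case=> h fh; exists (fun v => scale c (h v)) => w sw.
by rewrite (hd_morph (scale_map c)) fh.
Qed.

Lemma exact_add n f g : exact_on n f -> exact_on n g -> exact_on n (fun w => f w + g w).
Proof.
case=> hf ef [hg eg]; exists (fun v => hf v - (0 - hg v)) => w sw.
by rewrite !hdB hd0 sub0r opprK ef ?eg.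
Qed.

Lemma eq_exact n f g : (forall w, size w = n -> f w = g w) -> exact_on n f -> exact_on n g.
Proof. by move=> fg [h fh]; exists h => w sw; rewrite -fg ?fh. Qed.

Lemma brk_cocycleA p q f g (v : seq basis) b :
    (forall w, size w = q.+2 -> hd g w = 0) -> size v = (p + q).+2 ->
  brk p.+1 q (coef (hd f)) (coef g) v b = (-1) ^+ q * hd (bracket p q f g) v b.
Proof.
move=> cg sv; rewrite (hd_brk _ _ sv).
have -> : brk (p + q) 1 (coef (bracket p q f g)) mult v b =
    brk (p + q) 1 (brk p q (coef f) (coef g)) mult v b.
  by apply: eq_brk => // [w c _|]; rewrite ?addn1 //; rewrite /coef ffunE.
rewrite brk_cocycle // => [|w c sw]; last first.
  by apply/eqP; rewrite -oppr_eq0 -(hd_brk _ _ sw) cg // ffunE.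
have -> : brk p.+1 q (coef (hd f)) (coef g) v b =
    brk p.+1 q (fun w c => - brk p 1 (coef f) mult w c) (coef g) v b.
  by apply: eq_brk => // w c sw; apply: hd_brk.
(* The minus sign is pulled out of the first argument by additivity, from a cochain plus its
   opposite being zero. *)
have := brkDl p.+1 q (brk p 1 (coef f) mult)
  (fun w c => - brk p 1 (coef f) mult w c) (coef g) v b.
rewrite (_ : (fun w c => _ + _) = fun _ _ => 0) ?brk0l; last first.
  by do 2![apply: functional_extensionality => ?]; rewrite subrr.
move/eqP; rewrite eq_sym addrC addr_eq0 => /eqP->.
have e : (-1) ^+ q * (-1) ^+ q = 1 :> k by rewrite -expr2 sqrr_sign.
ring: e.
Qed.

Lemma bracket_hd_exact p q f g : (forall w, size w = q.+2 -> hd g w = 0) ->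
  exact_on (p + q).+2 (bracket p.+1 q (hd f) g).
Proof.
move=> cg; have : exact_on (p + q).+2 (hd (bracket p q f g)).
  by exists (bracket p q f g).
move/(exact_scale ((-1) ^+ q)); apply: eq_exact => w sw.
by apply/ffunP => b; rewrite !ffunE brk_cocycleA.
Qed.

Lemma bracketC p q f g w :
  bracket p q f g w = scale (- (-1) ^+ (p * q)) (bracket q p g f w).
Proof.
by apply/ffunP => b; rewrite !ffunE brkC [(q * p)%N]mulnC.
Qed.

Lemma bracketDl p q f f' g w :
  bracket p q (fun v => f v + f' v) g w = bracket p q f g w + bracket p q f' g w.
Proof.
apply/ffunP => b; rewrite !ffunE -brkDl; congr brk.
by do 2![apply: functional_extensionality => ?]; rewrite /coef ffunE.
Qed.

Lemma eq_bracketl p q f f' g w : (forall v, size v = p.+1 -> f v = f' v) ->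
  size w = (p + q).+1 -> bracket p q f g w = bracket p q f' g w.
Proof.
by move=> ff sw; apply/ffunP => b; rewrite !ffunE; apply: eq_brk => // v c sv; rewrite /coef ff.
Qed.

Lemma bracket_cocycle p q f g :
    (forall w, size w = p.+2 -> hd f w = 0) -> (forall w, size w = q.+2 -> hd g w = 0) ->
  forall w, size w = (p + q).+2 -> hd (bracket p q f g) w = 0.
Proof.
move=> cf cg w sw; apply/ffunP => b.
have := brk_cocycleA f b cg sw; rewrite (_ : brk _ _ _ _ _ _ = 0).
  move/eqP; rewrite eq_sym => /eqP e; rewrite ffunE.
  by rewrite -[LHS]mul1r -(sqrr_sign k q) expr2 -mulrA e mulr0.
rewrite -[RHS](brk0l p.+1 q (coef g) w b); apply: eq_brk => // v c sv.
by rewrite /coef cf // ffunE.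
Qed.

(** [[f, g]] splits as [[proj f, proj g] + [hd h, proj g] + [f, hd h']] with [h], [h'] from the
    homotopy. The last two are exact since their other entry is a cocycle; the first is a cocycle
    killed by [proj], hence exact by [cocycle_htpy]. *)
Lemma bracket_exact p q f g :
    (forall w, size w = p.+3 -> hd f w = 0) -> (forall w, size w = q.+3 -> hd g w = 0) ->
    (forall w, size w = (p.+1 + q.+1).+1 ->
       proj (bracket p.+1 q.+1 (proj f) (proj g)) w = 0) ->
  exact_on (p.+1 + q.+1).+1 (bracket p.+1 q.+1 f g).
Proof.
move=> cf cg pv.
have cpf w : size w = p.+3 -> hd (proj f) w = 0.
  by move=> sw; rewrite hd_proj (@eq_proj _ (hd f) (fun v => hd f v - hd f v))
    ?projB ?subrr // => v; rewrite sw subrr; apply: cf.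
have cpg w : size w = q.+3 -> hd (proj g) w = 0.
  by move=> sw; rewrite hd_proj (@eq_proj _ (hd g) (fun v => hd g v - hd g v))
    ?projB ?subrr // => v; rewrite sw subrr; apply: cg.
have E0 : exact_on (p.+1 + q.+1).+1 (bracket p.+1 q.+1 (proj f) (proj g)).
  exists (htpy (p.+1 + q.+1) (bracket p.+1 q.+1 (proj f) (proj g))) => w sw.
  rewrite -[RHS]add0r -(pv w sw); apply: cocycle_htpy => //.
  exact: bracket_cocycle.
have E1 : exact_on (p.+1 + q.+1).+1 (bracket p.+1 q.+1 (hd (htpy p.+1 f)) (proj g)).
  exact: bracket_hd_exact.
have E2 : exact_on (p.+1 + q.+1).+1 (bracket p.+1 q.+1 f (hd (htpy q.+1 g))).
  have := exact_scale (- (-1) ^+ (p.+1 * q.+1)) (bracket_hd_exact q (htpy q.+1 g) cf).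
  by rewrite [(q + _)%N]addnC addnS => /eq_exact; apply => w sw; rewrite [RHS]bracketC.
have := exact_add (exact_add E0 E1) E2; apply: eq_exact => w sw.
rewrite -bracketDl (@eq_bracketl _ _ _ f) //; last first.
  by move=> v sv; rewrite [RHS](cocycle_htpy cf sv).
rewrite ![bracket _ _ f _ w]bracketC -(mapD (scale_map _)) -bracketDl; congr scale.
by apply: eq_bracketl => [v sv|]; rewrite ?(cocycle_htpy cg sv) // addnC.
Qed.

End Algebra.

(** * Values of [proj] on chains of relations *)

Section Chains.
Variable M : bimodule.
Implicit Types (f : seq basis -> M).

Lemma tail_proj_chain a f b l : path Rel a (b :: l) ->
  tail_proj a f (map arrow (b :: l)) =
  rkey (f (map arrow (b :: l))) (t (last b l), [::]).
Proof.
elim: l a b f => [|c l IH] a b f /andP[ab bl]; first by rewrite tail_proj_cons /= ab.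
by rewrite [map _ _]/= tail_proj_cons /= ab IH.
Qed.

Lemma tail_proj_last a f l y : path Rel a l ->
  tail_proj a f (map arrow l ++ [:: y]) =
  if arr y is c :: v then
    if Rel (last a l) c then rkey (f (map arrow l ++ [:: arrow c])) (t c, v) else 0
  else 0.
Proof.
elim: l a f => [|b l IH] a f /=; first by move=> _; rewrite tail_proj_cons.
case/andP=> ab bl; rewrite tail_proj_cons /= ab; case: l IH bl => [|c l] IH bl;
exact: (IH b (fun v => f (arrow b :: v))).
Qed.

Lemma proj_arrow f a y w :
  proj f [:: arrow a, y & w] = lkey (s a, [::]) (tail_proj a (fun v => f (arrow a :: v)) (y :: w)).
Proof. by []. Qed.

Lemma proj_chain f a b l : path Rel a (b :: l) ->
  proj f (map arrow [:: a, b & l]) =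
  lkey (s a, [::]) (rkey (f (map arrow [:: a, b & l])) (t (last b l), [::])).
Proof. by move=> abl; rewrite [map _ _]/= proj_arrow tail_proj_chain. Qed.

(** In degrees above 1 each value of [proj f] is obtained by acting on at most one value of [f],
    taken at a chain. *)
Lemma proj_eq0 f w : (1 < size w)%N ->
    (forall a l, path Rel a l -> size w = (size l).+1 -> f (map arrow (a :: l)) = 0) ->
  proj f w = 0.
Proof.
have tail0 v a h : (forall l, path Rel a l -> size v = size l -> h (map arrow l) = 0) ->
    tail_proj a h v = 0 :> M.
  elim: v a h => [|y v IH] a h h0 //; rewrite tail_proj_cons.
  case: (arr y) => [|b p] //; case: ifP => // ab.
  case: v IH h0 => [|z v] IH h0; first by rewrite (h0 [:: b]) ?rkey0 //= ab.
  case: p => // ; apply: IH => l bl sl.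
  by apply: (h0 (b :: l)); [rewrite /= ab | move: sl => /= ->].
case: w => [|x [|y w]] // _ f0; rewrite /proj /head_proj.
case: (arr x) => [|a p] //; rewrite tail0 ?lkey0 // => l al sl.
by apply: f0; rewrite //= -sl.
Qed.

End Chains.

(** * The bracket vanishes on chains of a triangular gentle algebra *)

Section Vanishing.
Variable k : comNzRingType.
Hypothesis acyclic : triangular s t.
Hypothesis S3 : string_S3 s t Rel.
Hypothesis G1 : gentle_G1 s t Rel.
Implicit Types (f g : seq basis -> alg k) (x y z : basis).

Lemma rel_inj a b c : Rel a b -> Rel a c -> b = c.
Proof.
move=> ab ac; have /card_le1_eqP := G1.1 a; apply; rewrite inE.
  by rewrite (rel_path ac) eqxx.
by rewrite (rel_path ab) eqxx.
Qed.

Lemma rel_inj_l a b c : Rel a c -> Rel b c -> a = b.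
Proof.
move=> ac bc; have /card_le1_eqP := G1.2 c; apply; rewrite inE.
  by rewrite (rel_path bc) eqxx.
by rewrite (rel_path ac) eqxx.
Qed.

Lemma nonzero_inj a b c : nonzero a b -> nonzero a c -> b = c.
Proof. by move=> ab ac; have /card_le1_eqP := S3.1 a; apply; rewrite inE. Qed.

Lemma nonzero_inj_l a b c : nonzero a c -> nonzero b c -> a = b.
Proof. by move=> ac bc; have /card_le1_eqP := S3.2 c; apply; rewrite inE. Qed.

Lemma chain_acyclic a l : path Rel a l -> s a != t (last a l).
Proof.
move=> al; apply: acyclic; rewrite /consec /=.
by apply: sub_path al => b c /rel_path ->.
Qed.

Lemma lkey_nil v (phi : alg k) (b : basis) : lkey (v, [::]) phi b = if src b == v then phi b else 0.
Proof.
rewrite -[(v, _)]/(src (idem v), arr (idem v)) lkey_basis ffunE.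
transitivity (\sum_y (if y == b then (src b == v)%:R * phi b else 0)).
  apply: eq_bigr => y _; rewrite idem_pmul; case: (eqVneq y b) => [->|yb].
    by rewrite [src b == v]eq_sym; case: ifP => _; rewrite ?eqxx.
  by case: ifP => _; rewrite ?(inj_eq Some_inj) ?(negPf yb) mul0r.
by rewrite -big_mkcond big_pred1_eq; case: eqP; rewrite ?mul1r ?mul0r.
Qed.

Lemma rkey_nil v (phi : alg k) (b : basis) : rkey phi (v, [::]) b = if tgt b == v then phi b else 0.
Proof.
rewrite -[(v, _)]/(src (idem v), arr (idem v)) rkey_basis ffunE.
transitivity (\sum_y (if y == b then (tgt b == v)%:R * phi b else 0)).
  apply: eq_bigr => y _; rewrite pmul_idem; case: (eqVneq y b) => [->|yb].
    by case: ifP => _; rewrite ?eqxx.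
  by case: ifP => _; rewrite ?(inj_eq Some_inj) ?(negPf yb) mul0r.
by rewrite -big_mkcond big_pred1_eq; case: eqP; rewrite ?mul1r ?mul0r.
Qed.

(** The trivial paths acting in [proj] cut its value down to paths parallel to the chain. *)
Lemma proj_support f a b l x : path Rel a (b :: l) ->
    proj f (map arrow [:: a, b & l]) x != 0 ->
  src x = s a /\ tgt x = t (last b l).
Proof.
move=> abl; rewrite proj_chain // lkey_nil rkey_nil.
case: (src x =P s a) => [->|_]; last by rewrite eqxx.
by case: (tgt x =P t (last b l)) => [->|_] //; rewrite eqxx.
Qed.

(** If the arrow [a] were parallel to the chain, the nonempty rest [b :: l] would be an oriented
    cycle at the target of [a]. *)
Lemma proj_support_arrow f a b l : path Rel a (b :: l) ->
  proj f (map arrow [:: a, b & l]) (arrow a) = 0.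
Proof.
move=> abl; apply/eqP/negP => /negP/(proj_support abl)[_ e].
case/andP: abl => ab /chain_acyclic; rewrite -(rel_path ab).
by rewrite -e eqxx.
Qed.

(** An inserted letter that is not the last one counts only if it is an arrow following [a] in a
    relation. By (G1) this is the arrow [c] of the chain itself, where the coefficient of [g] is
    zero by assumption. Only the final position survives. *)
Lemma insert_tail_proj q r (g : seq basis -> basis -> k) a f l (b0 : basis) :
    (forall c d m, path Rel c (d :: m) -> g (map arrow [:: c, d & m]) (arrow c) = 0) ->
    path Rel a l -> size l = (r + q.+1).+1 ->
  insert q.+1 g (fun w => tail_proj a f w b0) (map arrow l) =
  (-1) ^+ (r * q.+1) * \sum_x g (map arrow (drop r l)) x *
    tail_proj a f (map arrow (take r l) ++ [:: x]) b0.
Proof.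
move=> g0; elim: r a f l => [|r IH] a f l al sl.
  by rewrite insert_exact ?size_map // mul1r drop0 take0.
case: l al sl => // c l /andP[ac cl] [sl].
rewrite [map _ _]/= insert_cons.
have -> : insert0 q.+1 g (fun w => tail_proj a f w b0) (arrow c :: map arrow l) = 0.
  rewrite /insert0; case: ifP => // _; rewrite big1 // => x _.
  rewrite -[arrow c :: _]/(map arrow (c :: l)) -map_take -map_drop.
  rewrite tail_proj_cons; case ax: (arr x) => [|d p]; first by rewrite ffunE mulr0.
  case: ifP => [ad|_]; last by rewrite ffunE mulr0.
  case dl: (map _ (drop _ _)) => [|z w].
    by move/(congr1 size): dl; rewrite size_map size_drop /= sl; lia.
  case: p ax => [|? ?] ax; last by rewrite ffunE mulr0.
  have -> : x = arrow c.
    by rewrite (rel_inj ac ad); apply: basis_eq; rewrite ?ax // (arr_cons ax).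
  case: l cl sl {dl} => [|d' l] cl sl; first by move: sl; rewrite addSn.
  rewrite [take _ _]/= g0 ?mul0r //; case/andP: cl => /= -> cl.
  exact: take_path.
rewrite add0r (@eq_insert _ _ _ g g _ (fun w => tail_proj c (fun v => f (arrow c :: v)) w b0)) //.
  by rewrite IH // mulSn exprD mulrA /= ; congr (_ * _); apply: eq_bigr => x _;
    rewrite [in RHS]tail_proj_cons /= ac; case: (take r l).
by move=> w; rewrite size_map sl addnK tail_proj_cons /= ac; case: w.
Qed.

(** The two outer insertions remain; the final one is at position [p.+1], counted from 0, whence its
    sign. *)
Lemma insert_proj p q f g a l (b : basis) :
    path Rel a l -> size l = (p.+1 + q.+1)%N ->
  insert q.+1 (coef (proj g)) ((proj f)^~ b) (map arrow (a :: l)) =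
  \sum_x proj g (map arrow (take q.+2 (a :: l))) x *
    proj f (x :: map arrow (drop q.+2 (a :: l))) b
  + (-1) ^+ (p.+1 * q.+1) *
  \sum_x proj g (map arrow (drop p.+1 (a :: l))) x *
    proj f (map arrow (take p.+1 (a :: l)) ++ [:: x]) b.
Proof.
move=> al sl; rewrite [map _ (a :: l) in LHS]/= insert_cons; congr (_ + _).
  rewrite -[arrow a :: _]/(map arrow (a :: l)) /insert0 ifT.
    by rewrite map_take map_drop.
  by rewrite size_map /= sl; lia.
rewrite mulSn exprD -mulrA; congr (_ * _).
have g0 c d m : path Rel c (d :: m) -> coef (proj g) (map arrow [:: c, d & m]) (arrow c) = 0.
  exact: proj_support_arrow.
have projE w : (0 < size w)%N -> proj f (arrow a :: w) b =
    0 + (src b == s a)%:R * tail_proj a (fun v => f (arrow a :: v)) w b.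
  case: w => // y w _; rewrite proj_arrow lkey_nil add0r.
  by case: eqP; rewrite ?mul1r ?mul0r.
rewrite (@eq_insert _ _ _ _ (coef (proj g)) _ (fun w => 0 + (src b == s a)%:R *
    tail_proj a (fun v => f (arrow a :: v)) w b)) //; last first.
  by move=> w sw; apply: projE; rewrite sw size_map sl addnK.
rewrite insert_linr (@insert_tail_proj _ p) //.
rewrite insert_const0 add0r.
rewrite mulrCA; congr (_ * _); rewrite mulr_sumr; apply: eq_bigr => x _.
rewrite mulrCA; congr (_ * _); rewrite /= projE ?add0r //.
by rewrite size_cat addn1.
Qed.

Lemma key_init x u c : arr x = rcons u c -> exists z,
  [/\ key (src x, u) = Some z, src z = src x, arr z = u & tgt z = s c].
Proof.
move=> ax; have := basis_valid x; rewrite ax -cats1 => /valid_cat/andP[vu].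
rewrite valid_cons => /andP[/eqP sc _]; have [z [kz sz az]] := key_valid vu.
by exists z; split=> //; rewrite /tgt sz az.
Qed.

Lemma key_tail y c v : arr y = c :: v -> exists z,
  [/\ key (t c, v) = Some z, src z = t c & arr z = v].
Proof.
move=> ay; have := basis_valid y; rewrite ay -[c :: v]/([:: c] ++ v).
by case/valid_cat/andP=> _ /key_valid[z [kz sz az]]; exists z.
Qed.

(** [take (size (arr x)).-1 (arr x)] is [u] for [x = u c], and the first test fails for trivial [x].
    By (G1) only [c] precedes [e] in a relation, so a contributing [x] ends in [c]. *)
Lemma proj_head_sum f x c e l (b : basis) : path Rel c (e :: l) ->
  proj f (x :: map arrow (e :: l)) b =
  \sum_y [&& arr x == rcons (take (size (arr x)).-1 (arr x)) c, src b == src x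
    & arr b == take (size (arr x)).-1 (arr x) ++ arr y]%:R *
    proj f (map arrow [:: c, e & l]) y.
Proof.
move=> cel; have ce : Rel c e by case/andP: cel.
have -> : proj f (x :: map arrow (e :: l)) =
  head_proj f (src x) (arr x) (map arrow (e :: l)) by [].
have [ax|[u [d ax]]] := nil_or_rcons (arr x).
  by rewrite ax /= ffunE big1 // => y _; rewrite mul0r.
have tu : take (size u) (rcons u d) = u by rewrite -cats1 take_size_cat.
rewrite ax size_rcons tu head_proj_rcons.
case: (eqVneq d c) => [dc|dc]; last first.
  rewrite big1 => [|y _]; last by rewrite eqseq_rcons (negPf dc) andbF mul0r.
  rewrite [map _ _]/= tail_proj_cons /=.
  case: ifP => [de|_]; last by rewrite lkey0 ffunE.
  by case/eqP: dc; apply: rel_inj_l de ce.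
subst d; have [z [kz sz az tz]] := key_init ax.
have -> : lkey (src x, u) (tail_proj c (fun v => f (arrow c :: v)) (map arrow (e :: l))) =
    lkey (src x, u) (proj f (map arrow [:: c, e & l])).
  rewrite [map _ [:: c, e & l]]/= proj_arrow lkeyM.
  by rewrite (_ : endv _ _ _ = s c) ?eqxx ?cats0 // -tz /tgt sz az.
have supp y : proj f (map arrow [:: c, e & l]) y != 0 -> src y = s c.
  by move/(proj_support cel)=> [].
move: (proj f (map arrow [:: c, e & l])) supp => phi supp.
rewrite /lkey kz /= ffunE; apply: eq_bigr => y _; rewrite eqxx /=.
have [->|/supp sy] := eqVneq (phi y) 0; first by rewrite !mulr0.
congr (_%:R * _); congr nat_of_bool.
apply/eqP/andP => [/pmul_Some[_ -> ->]|[/eqP sb /eqP ab]]; first by rewrite sz az !eqxx.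
by apply/pmul_Some; rewrite tz sy sz az.
Qed.

Lemma proj_support_rcons f a c l x : path Rel a (rcons l c) ->
  proj f (map arrow (rcons (a :: l) c)) x != 0 -> src x = s a /\ tgt x = t c.
Proof.
case: l => [|b l] alc; first exact: (@proj_support f a c [::]).
by move=> /(proj_support alc); rewrite last_rcons.
Qed.

(** Mirror image of [proj_head_sum]: [behead (arr y)] is [v] for [y = c v], and by (G1) only [c]
    continues the chain [a :: l] by a relation. *)
Lemma proj_last_sum f y a c l (b : basis) : path Rel a (rcons l c) ->
  proj f (map arrow (a :: l) ++ [:: y]) b =
  \sum_x [&& arr y == c :: behead (arr y), src b == src x
    & arr b == arr x ++ behead (arr y)]%:R *
    proj f (map arrow (rcons (a :: l) c)) x.
Proof.
move=> alc; have := alc; rewrite rcons_path => /andP[al lc].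
pose w := map arrow (a :: l).
have projE z : proj f (w ++ [:: z]) = lkey (s a, [::])
    (tail_proj a (fun v => f (arrow a :: v)) (map arrow l ++ [:: z])).
  by rewrite /w; case: (l).
have cE : map arrow (rcons (a :: l) c) = w ++ [:: arrow c] by rewrite map_rcons -cats1.
have pcE : proj f (w ++ [:: arrow c]) =
    lkey (s a, [::]) (rkey (f (w ++ [:: arrow c])) (t c, [::])).
  by rewrite projE tail_proj_last //= lc.
rewrite -/w projE tail_proj_last // cE.
case ay: (arr y) => [|d v]; first by rewrite lkey0 ffunE big1 // => x _; rewrite mul0r.
rewrite -[behead (d :: v)]/v eqseq_cons eqxx andbT.
case: (eqVneq d c) => [dc|dc]; last first.
  rewrite big1 => [|x _]; last by rewrite mul0r.
  case: ifP => [ld|_]; last by rewrite lkey0 ffunE.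
  by case/eqP: dc; apply: rel_inj ld lc.
subst d; have [z [kz sz az]] := key_tail ay; rewrite lc.
have -> : lkey (s a, [::]) (rkey (f (arrow a :: map arrow l ++ [:: arrow c])) (t c, v)) =
    rkey (proj f (w ++ [:: arrow c])) (t c, v).
  by rewrite pcE -lrkey rkeyM eqxx.
have supp x : proj f (w ++ [:: arrow c]) x != 0 -> tgt x = t c.
  by rewrite -cE => /(proj_support_rcons alc)[].
move: (proj f (w ++ _)) supp => phi supp.
rewrite /rkey kz /= ffunE; apply: eq_bigr => x _.
have [->|/supp tx] := eqVneq (phi x) 0; first by rewrite !mulr0.
congr (_%:R * _); congr nat_of_bool.
apply/eqP/andP => [/pmul_Some[_ -> ->]|[/eqP sb /eqP ab]]; first by rewrite az !eqxx.
by apply/pmul_Some; rewrite sz tx az.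
Qed.

(* The first insertion of one bracket term against the last insertion of the
   other: both overlap the two chains in the single arrow [c]. *)
Lemma overlap_sum f g a l1 c e l2 (b : basis) :
    path Rel a (rcons l1 c) -> path Rel c (e :: l2) ->
  \sum_x proj g (map arrow (rcons (a :: l1) c)) x *
    proj f (x :: map arrow (e :: l2)) b =
  \sum_y proj f (map arrow [:: c, e & l2]) y *
    proj g (map arrow (a :: l1) ++ [:: y]) b.
Proof.
move=> al cl.
under eq_bigr do rewrite (proj_head_sum _ _ _ cl) mulr_sumr.
rewrite exchange_big; apply: eq_bigr => y _ /=.
rewrite (proj_last_sum _ _ _ al) mulr_sumr; apply: eq_bigr => x _.
have [->|gx] := eqVneq (proj g (map arrow (rcons (a :: l1) c)) x) 0.
  by rewrite mul0r !mulr0.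
have [->|fy] := eqVneq (proj f (map arrow [:: c, e & l2]) y) 0.
  by rewrite mul0r !mulr0.
have [sx tx] := proj_support_rcons al gx; have [sy ty] := proj_support cl fy.
rewrite mulrCA [RHS]mulrCA [X in _ = _ * X]mulrC; congr (_%:R * _).
congr nat_of_bool.
have /andP[al1 l1c] : path Rel a l1 && Rel (last a l1) c by rewrite -rcons_path.
have /andP[ce el2] := cl.
(* By acyclicity these inequalities exclude, in this order, [x] trivial, [x = c], [y] trivial and
   [y = c]. *)
have sa_tc : s a != t c by have := chain_acyclic al; rewrite last_rcons.
have sa_sc : s a != s c by rewrite -(rel_path l1c) chain_acyclic.
have sc_te : s c != t (last e l2) by have := chain_acyclic cl.
have tc_te : t c != t (last e l2) by rewrite (rel_path ce) chain_acyclic.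
(* First [x = u c] and [b = u y]. If [u] ends in [d] and [y] starts with [d'], both [d c] and [d d']
   are nonzero, so (S3) gives [d' = c]; hence [y = c v] and [b = x v]. *)
apply/and3P/and3P => -[/eqP e1 /eqP sb /eqP e2].
  move: (take _ _) e1 e2 => u ax ab.
  have [u0|[u' [d ud]]] := nil_or_rcons u.
    by case/eqP: sa_sc; rewrite -sx; apply: (@arr_cons x c [::]); rewrite ax u0.
  case ay: (arr y) => [|d' v].
    by case/eqP: sc_te; rewrite -ty -sy /tgt ay.
  have dc : nonzero d c by apply: (@arr_nonzero x u' d c [::]); rewrite ax ud -cats1 cat_rcons.
  have dd' : nonzero d d' by apply: (@arr_nonzero b u' d d' v); rewrite ab ay ud cat_rcons.
  rewrite /= (nonzero_inj dd' dc) ax cat_rcons; split; rewrite ?sb //.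
  by rewrite ab ay (nonzero_inj dd' dc).
(* Conversely [y = c v] and [b = x v]. If [v] starts with [d'] and [x] ends in [d], both [c d'] and
   [d d'] are nonzero, so (S3) gives [d = c]. *)
move: (behead _) e1 e2 => [|d' v] ay ab.
  by case/eqP: tc_te; rewrite -ty (tgt_cons ay).
have [x0|[u [d ax]]] := nil_or_rcons (arr x).
  by case/eqP: sa_tc; rewrite -sx -tx /tgt x0.
have cd' : nonzero c d' by apply: (@arr_nonzero y [::] c d' v).
have dd' : nonzero d d' by apply: (@arr_nonzero b u d d' v); rewrite ab ax cat_rcons.
have dc := nonzero_inj_l dd' cd'; rewrite ax dc size_rcons /= -cats1 take_size_cat //.
by rewrite cats1 ab ax ay dc cat_rcons sb !eqxx.
Qed.

(** Each of the two compositions is a first insertion plus s times a final one, s being the sign in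
    the bracket. By [overlap_sum] the first insertion in one equals the final insertion in the
    other, and s squared is 1, so the four terms cancel in pairs. *)
Lemma bracket_proj_chain p q f g a l : path Rel a l -> size l = (p.+1 + q.+1)%N ->
  bracket p.+1 q.+1 (proj f) (proj g) (map arrow (a :: l)) = 0.
Proof.
move=> al sl; apply/ffunP => b; rewrite !ffunE /brk /ins_comp.
have key_eq p' q' f' g' : (p' + q' = p + q)%N ->
    \sum_x proj g' (map arrow (take q'.+2 (a :: l))) x *
      proj f' (x :: map arrow (drop q'.+2 (a :: l))) b =
    \sum_y proj f' (map arrow (drop q'.+1 (a :: l))) y *
      proj g' (map arrow (take q'.+1 (a :: l)) ++ [:: y]) b.
  move=> pq; have lt : (q' < size l)%N by rewrite sl; lia.
  rewrite [drop q'.+1 _]/= (drop_nth a lt) [take q'.+2 _]/= (take_nth a lt).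
  rewrite [take q'.+1 _]/= [drop q'.+2 _]/=.
  have := al; rewrite -{1}(cat_take_drop q'.+1 l) (take_nth a lt) cat_path last_rcons.
  case/andP=> al1 cl; case dl: (drop q'.+1 l) cl => [|e l2] cl.
    by move/(congr1 size): dl; rewrite size_drop sl /=; lia.
  exact: (overlap_sum f' g' b al1 cl).
have sl' : size l = (q.+1 + p.+1)%N by rewrite sl addnC.
rewrite (insert_proj _ _ _ al sl) (insert_proj _ _ _ al sl').
rewrite (key_eq p q) // (key_eq q p) 1?addnC //.
have e : (-1) ^+ (p.+1 * q.+1) * (-1) ^+ (p.+1 * q.+1) = 1 :> k.
  by rewrite -expr2 sqrr_sign.
rewrite [(q.+1 * p.+1)%N]mulnC; ring: e.
Qed.

Theorem bracket_exact_gentle p q f g :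
    (forall w, size w = p.+3 -> hd f w = 0) -> (forall w, size w = q.+3 -> hd g w = 0) ->
  exact_on (p.+1 + q.+1).+1 (bracket p.+1 q.+1 f g).
Proof.
move=> cf cg; apply: bracket_exact => // w sw; apply: proj_eq0; first by rewrite sw; lia.
by move=> a l al sl; apply: bracket_proj_chain => //; move: sl; rewrite sw => -[].
Qed.

End Vanishing.
End Paths.

(** * Multilinear extension from path coordinates *)

Section Coordinates.
Local Open Scope ring_scope.
Variables (V E : finType) (s t : E -> V) (Rel : rel E) (N : nat).
Hypothesis bounded : forall p : seq E, size p = N -> consec s t p -> in_ideal Rel p.
Variable k : fieldType.

Local Notation basis := (basis s t Rel N).
Local Notation F := (F V E k).
Local Notation inA := (@inA V E s t Rel k).
Local Notation valid := (valid s t Rel).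
Local Notation cochain := (@cochain V E s t Rel k).
Arguments Defs.valid : simpl never.

Definition delta (b : basis) : F := fun q => (q == ssval b)%:R.

Lemma delta_inA b : inA (delta b).
Proof.
move=> q nq; rewrite /delta; case: eqP => // qb.
by move: nq; rewrite qb -(mem_paths bounded) (ssvalP b).
Qed.

Lemma Forall_delta w : List.Forall inA (map delta w).
Proof. by elim: w => [|b w IH]; constructor=> //; apply: delta_inA. Qed.

Lemma Forall_cat (T : Type) (P : T -> Prop) l1 l2 :
  List.Forall P (l1 ++ l2) <-> List.Forall P l1 /\ List.Forall P l2.
Proof.
elim: l1 => [|x l1 IH] /=; first by split=> [|[]].
split=> [H|[H1 H2]].
  by case/List.Forall_cons_iff: H => Px /IH[]; split=> //; constructor.
by case/List.Forall_cons_iff: H1 => Px H1; constructor=> //; apply/IH.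
Qed.

Lemma delta_basis b c : delta b (ssval c) = (b == c)%:R.
Proof. by rewrite /delta eq_sym (inj_eq val_inj). Qed.

(** Multilinear extension from basis words. It reads only coordinates at keys in [basis], and these
    determine the elements of A. *)
Fixpoint ext (h : seq basis -> k) (l : seq F) : k :=
  if l is x :: l' then \sum_b x (ssval b) * ext (fun w => h (b :: w)) l' else h [::].

Lemma eq_ext h h' l : (forall w, size w = size l -> h w = h' w) -> ext h l = ext h' l.
Proof.
elim: l h h' => [|x l IH] h h' hh /=; first exact: hh.
apply: eq_bigr => b _; congr (_ * _); apply: IH => w sw.
by apply: hh; rewrite /= sw.
Qed.

Lemma ext_delta h w : ext h (map delta w) = h w.
Proof.
elim: w h => [|b w IH] h //=; rewrite (bigD1 b) //= delta_basis eqxx mul1r IH.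
by rewrite big1 ?addr0 // => c cb; rewrite delta_basis eq_sym (negPf cb) mul0r.
Qed.

Lemma ext_sum (I : finType) (c : I -> k) (h : I -> seq basis -> k) l :
  ext (fun w => \sum_i c i * h i w) l = \sum_i c i * ext (h i) l.
Proof.
elim: l h => [|x l IH] h //=.
under eq_bigr do rewrite (IH (fun i w => h i (_ :: w))) mulr_sumr.
rewrite exchange_big; apply: eq_bigr => i _; rewrite mulr_sumr.
by apply: eq_bigr => b _; ring.
Qed.

Lemma ext_lin c d h h' l :
  ext (fun w => c * h w + d * h' w) l = c * ext h l + d * ext h' l.
Proof.
elim: l h h' => [|x l IH] h h' //=.
rewrite !mulr_sumr -big_split; apply: eq_bigr => b _ /=.
rewrite (IH (fun w => h (b :: w))); ring.
Qed.

Lemma extN h l : ext (fun w => - h w) l = - ext h l.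
Proof.
elim: l h => [|x l IH] h //=; rewrite -sumrN.
by apply: eq_bigr => b _; rewrite (IH (fun w => h (b :: w))) mulrN.
Qed.

Lemma ext_cat h l1 l2 :
  ext h (l1 ++ l2) = ext (fun w1 => ext (fun w2 => h (w1 ++ w2)) l2) l1.
Proof. by elim: l1 h => [|x l1 IH] h //=; apply: eq_bigr => b _; rewrite IH. Qed.

Lemma ext_multilinear h l1 l2 c x y :
  ext h (l1 ++ addF (scaleF c x) y :: l2) =
  c * ext h (l1 ++ x :: l2) + ext h (l1 ++ y :: l2).
Proof.
rewrite !ext_cat -[X in _ + X]mul1r -ext_lin; apply: eq_ext => w _ /=.
rewrite mulr_sumr mul1r -big_split; apply: eq_bigr => b _ /=.
by rewrite /addF /scaleF; ring.
Qed.

Section Cochain.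
Variables (n : nat) (f : seq F -> F).
Hypothesis fc : cochain n f.

Lemma cochain_sum l1 l2 (c : basis -> k) (r : seq basis) q :
    (size l1 + size l2).+1 = n -> List.Forall inA l1 -> List.Forall inA l2 ->
  f (l1 ++ (fun p => \sum_(b <- r) c b * delta b p) :: l2) q =
  \sum_(b <- r) c b * f (l1 ++ delta b :: l2) q.
Proof.
move=> sl A1 A2; have [_ flin] := fc.
have sumA r' : inA (fun p => \sum_(b <- r') c b * delta b p).
  by move=> p np; apply: big1 => b _; rewrite delta_inA ?mulr0.
elim: r => [|b r IH].
  (* The empty sum [z] is zero, written as [- z + z] so that multilinearity yields the value
     zero. *)
  rewrite big_nil; set z : F := fun p => _.
  have zA : inA z := sumA [::].
  rewrite (_ : z = addF (scaleF (-1) z) z); first by rewrite flin // mulN1r addNr.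
  by apply: functional_extensionality => p; rewrite /addF /scaleF mulN1r addNr /z big_nil.
rewrite big_cons -IH -(flin l1 l2) //; last exact: delta_inA.
congr (f (_ ++ _ :: _) q); apply: functional_extensionality => p.
by rewrite big_cons.
Qed.

Lemma inA_sum (x : F) : inA x -> x = fun p => \sum_(b <- index_enum basis) x (ssval b) * delta b p.
Proof.
move=> xA; apply: functional_extensionality => p.
case vp: (valid p); last first.
  rewrite xA ?vp // big1 // => b _; rewrite (delta_inA b) ?mulr0 //.
  by rewrite vp.
have [b [_ sb ab]] := key_valid bounded vp.
have pb : p = ssval b by rewrite [p]surjective_pairing -sb -ab -surjective_pairing.
rewrite pb (bigD1 b) //= delta_basis eqxx mulr1 big1 ?addr0 // => c cb.
by rewrite delta_basis (negPf cb) mulr0.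
Qed.

(** Arguments are expanded one at a time from the left; [w] records the basis paths chosen so
    far. *)
Lemma cochain_cat w l q : size w + size l = n -> List.Forall inA l ->
  f (map delta w ++ l) q = ext (fun v => f (map delta (w ++ v)) q) l.
Proof.
elim: l w => [|x l IH] w; first by rewrite /= !cats0.
move=> sl /List.Forall_cons_iff[xA Al].
rewrite {1}(inA_sum xA) cochain_sum ?size_map //; last 2 first.
- by rewrite -addnS.
- exact: Forall_delta.
apply: eq_bigr => b _; congr (_ * _).
rewrite -cat_rcons -map_rcons IH ?size_rcons ?addSnnS //.
  by apply: eq_ext => v _; rewrite cat_rcons.
by move: sl => /=; lia.
Qed.

Lemma cochain_ext l q : size l = n -> List.Forall inA l ->
  f l q = ext (fun v => f (map delta v) q) l.
Proof. by move=> sl Al; rewrite -(@cochain_cat [::]). Qed.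

End Cochain.

Definition coord (f : seq F -> F) (w : seq basis) (b : basis) : k :=
  f (map delta w) (ssval b).

Lemma Forall_take (P : F -> Prop) j l : List.Forall P l -> List.Forall P (take j l).
Proof. by rewrite -{1}(cat_take_drop j l) => /Forall_cat[]. Qed.

Lemma Forall_drop (P : F -> Prop) j l : List.Forall P l -> List.Forall P (drop j l).
Proof. by rewrite -{1}(cat_take_drop j l) => /Forall_cat[]. Qed.

Lemma insertion_ext p q f g l1 l2 l3 b :
    cochain p.+1 f -> cochain q.+1 g ->
    (size l1 + size l3 = p)%N -> size l2 = q.+1 ->
    List.Forall inA l1 -> List.Forall inA l2 -> List.Forall inA l3 ->
  f (l1 ++ g l2 :: l3) (ssval b) =
  ext (fun w => \sum_c coord g (take q.+1 (drop (size l1) w)) c *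
    coord f (take (size l1) w ++ c :: drop (size l1 + q.+1) w) b) (l1 ++ l2 ++ l3).
Proof.
move=> fc gc s13 s2 A1 A2 A3.
have gA : inA (g l2) by apply: gc.1.
rewrite (cochain_ext fc); last 2 first.
- by rewrite size_cat /= addnS s13.
- by apply/Forall_cat; split=> //; constructor.
rewrite !ext_cat; apply: eq_ext => w1 s1 /=.
rewrite ext_cat.
transitivity (ext (fun w2 => \sum_c coord g w2 c *
    ext (fun w3 => coord f (w1 ++ c :: w3) b) l3) l2).
  transitivity (\sum_c ext (fun w3 => coord f (w1 ++ c :: w3) b) l3 * ext (coord g ^~ c) l2).
    by apply: eq_bigr => c _; rewrite mulrC (cochain_ext gc).
  by rewrite -ext_sum; apply: eq_ext => w2 _; apply: eq_bigr => c _; rewrite mulrC.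
apply: eq_ext => w2 sw2; rewrite -ext_sum; apply: eq_ext => w3 _.
apply: eq_bigr => c _; congr (coord g _ c * coord f (_ ++ _ :: _) b).
- by rewrite -s1 drop_size_cat // take_size_cat // sw2.
- by rewrite -s1 take_size_cat.
- by rewrite catA drop_size_cat // size_cat s1 sw2 s2.
Qed.

Lemma gcirc_ext p q f g l b : cochain p.+1 f -> cochain q.+1 g ->
    size l = (p + q).+1 -> List.Forall inA l ->
  gcirc p.+1 q.+1 f g l (ssval b) =
  ext (fun w => ins_comp q (coord g) (coord f) w b) l.
Proof.
move=> fc gc sl Al.
transitivity (ext (fun w => \sum_(j < p.+1) (-1) ^+ (j * q) *
  \sum_c coord g (take q.+1 (drop j w)) c *
    coord f (take j w ++ c :: drop (j + q.+1) w) b) l); last first.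
  apply: eq_ext => w sw; rewrite /ins_comp insertE sw sl.
  by rewrite -addSn addnK.
rewrite ext_sum; apply: eq_bigr => j _.
(* [gcirc] uses the exponent [j * m.+1] with [m = q.+1], whereas [insert] produces [j * (m - 1)]. *)
have -> : (-1) ^+ (j * q.+2) = (-1) ^+ (j * q) :> k.
  by rewrite !mulnS !exprD mulrA -expr2 sqrr_sign mul1r.
congr (_ * _); have jp : (j <= p)%N by rewrite -ltnS.
have sj : size (take j l) = j by rewrite size_takel // sl; lia.
rewrite (insertion_ext _ fc gc) ?size_drop ?size_takel ?sj ?sl //; try lia.
- by rewrite [in drop (j + _) l]addnC -drop_drop !cat_take_drop.
- by rewrite size_drop sl; lia.
- exact: Forall_take.
- exact/Forall_take/Forall_drop.
- exact: Forall_drop.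
Qed.

Lemma gbracket_ext p q f g l b : cochain p.+1 f -> cochain q.+1 g ->
    size l = (p + q).+1 -> List.Forall inA l ->
  gbracket p.+1 q.+1 f g l (ssval b) =
  ext (fun w => brk p q (coord f) (coord g) w b) l.
Proof.
move=> fc gc sl Al; rewrite /gbracket (gcirc_ext _ fc gc) // (gcirc_ext _ gc fc) //; last first.
  by rewrite addnC.
have -> : (-1) ^+ (p.+2 * q.+2) = (-1) ^+ (p * q) :> k.
  by rewrite -signr_odd oddM /= !negbK -oddM signr_odd.
rewrite -[X in X - _]mul1r -mulNr -ext_lin; apply: eq_ext => w _.
by rewrite mul1r mulNr.
Qed.

Definition mulL (l : seq F) : F := mulF s t Rel (nth (@zeroF _ _ k) l 0) (nth (@zeroF _ _ k) l 1).

Lemma mulL_cochain : cochain 2 mulL.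
Proof.
split=> [l _ _ q /negPf nq|]; first by rewrite /mulL /mulF nq.
move=> [|y1 [|y2 l1]] [|z1 [|z2 l2]] x y c //= _ _ _ _ _ q;
  rewrite /mulL /mulF /=; case: ifP => _; rewrite ?mulr0 ?addr0 //.
  rewrite mulr_sumr -big_split; apply: eq_bigr => i _ /=.
  by rewrite /addF /scaleF; ring.
rewrite mulr_sumr -big_split; apply: eq_bigr => i _ /=.
by rewrite /addF /scaleF; ring.
Qed.

(** The convolution runs over all cuts of the path [b]; for basis paths only the cut after
    [size (arr x)] arrows can contribute, and it does so exactly when [x y = b]. *)
Lemma coord_mulL w b : size w = 2 -> coord mulL w b = mult k w b.
Proof.
case: w => [|x [|y [|z w]]] // _; rewrite /coord /mulL /mulF /=.
have vb := basis_valid bounded b; rewrite /src /arr -surjective_pairing in vb.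
rewrite vb; pose D i := delta x (src b, take i (arr b)) *
  delta y (endv t (src b) (take i (arr b)), drop i (arr b)).
have DP i : D i != 0 -> [/\ src b = src x, take i (arr b) = arr x & pmul x y = Some b].
  rewrite /D /delta; case: (_ =P ssval x) => [ex|_]; last by rewrite mul0r eqxx.
  case: (_ =P ssval y) => [ey _|_]; last by rewrite mulr0 eqxx.
  have [sx ax] : src b = src x /\ take i (arr b) = arr x by rewrite /src /arr -ex.
  split=> //; apply/pmul_Some => //; split=> //.
    by rewrite /tgt -sx -ax [RHS]/src -ey.
  by rewrite -ax [in X in _ ++ X]/arr -ey cat_take_drop.
rewrite -[LHS]/(\sum_(i < (size (arr b)).+1) D i).
have [xy|nxy] := eqVneq (pmul x y) (Some b); last first.
  by apply: big1 => i _; apply/eqP/negP => /negP/DP[_ _ xy]; rewrite xy eqxx in nxy.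
have [tx sb ab] := (pmul_Some bounded _ _ _).1 xy.
have lt : (size (arr x) < (size (arr b)).+1)%N by rewrite ab size_cat ltnS leq_addr.
rewrite (bigD1 (Ordinal lt)) //= big1 => [|i ni]; last first.
  apply/eqP/negP => /negP/DP[_ tb _]; case/eqP: ni; apply: val_inj => /=.
  by rewrite -tb size_takel // -ltnS.
rewrite addr0 /D ab take_size_cat // drop_size_cat // sb -/(tgt x) tx.
by rewrite /delta /src /arr -!surjective_pairing !eqxx mulr1.
Qed.

Lemma hoch_diff_gbracket p f l q : size l = p.+2 ->
  hoch_diff s t Rel p.+1 f l q = - gbracket p.+1 2 f mulL l q.
Proof.
move=> sl; rewrite /hoch_diff /gbracket opprB.
have e1 : gcirc p.+1 2 f mulL l q =
    - \sum_(i < p.+1) (-1) ^+ i.+1 * f (mergeAt s t Rel i l) q.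
  rewrite -sumrN; apply: eq_bigr => i _; rewrite mulnC /mergeAt.
  have -> : (-1) ^+ (3 * i) = - (-1) ^+ i.+1 :> k.
    by rewrite exprS mulN1r opprK -signr_odd oddM /= signr_odd.
  rewrite mulNr addn2; congr (- (_ * f (_ ++ _ :: _) q)).
  by rewrite /mulL !nth_take // !nth_drop addn0 addn1.
have e2 : gcirc 2 p.+1 mulL f l q =
    mulF s t Rel (f (take p.+1 l)) (nth (@zeroF _ _ k) l p.+1) q
    + (-1) ^+ p.+2 * mulF s t Rel (head (@zeroF _ _ k) l) (f (behead l)) q.
  rewrite /gcirc !big_ord_recl big_ord0 addr0 mul0n mul1r /bump /= !add0n mul1n drop0.
  case: l sl {e1} => // x l [sl]; rewrite /mulL /= drop0 [take p.+1 l]take_oversize ?sl //.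
  by rewrite nth_drop addn0 take0.
rewrite e1 e2 opprK.
have -> : (-1) ^+ (p.+2 * 3) = (-1) ^+ p.+2 :> k.
  by rewrite -signr_odd oddM andbT signr_odd.
have e : (-1) ^+ p.+2 * (-1) ^+ p.+2 = 1 :> k by rewrite -expr2 sqrr_sign.
ring: e.
Qed.

Lemma hoch_diff_ext p f l b : cochain p.+1 f -> size l = p.+2 -> List.Forall inA l ->
  hoch_diff s t Rel p.+1 f l (ssval b) =
  ext (fun w => - brk p 1 (coord f) (mult k) w b) l.
Proof.
move=> fc sl Al; rewrite hoch_diff_gbracket //.
rewrite (gbracket_ext _ fc mulL_cochain) ?addn1 //.
rewrite -extN; apply: eq_ext => w sw; congr (- _).
by apply: eq_brk => // [v c sv|]; [apply: coord_mulL | rewrite sw sl addn1].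
Qed.

Definition to_alg (f : seq F -> F) (w : seq basis) : alg bounded k :=
  [ffun b => coord f w b].

Lemma coef_to_alg f : coef (to_alg f) = coord f.
Proof.
by do 2![apply: functional_extensionality => ?]; rewrite /coef ffunE.
Qed.

Lemma to_alg_cocycle p f : cocycle s t Rel p.+1 f ->
  forall w, size w = p.+2 -> hd (to_alg f) w = 0.
Proof.
case=> fc f0 w sw; apply/ffunP => b; rewrite (hd_brk _ _ sw) coef_to_alg ffunE.
rewrite -[LHS](ext_delta (fun w => - brk p 1 (coord f) (mult k) w b)).
by rewrite -hoch_diff_ext ?size_map //; [apply: f0; rewrite ?size_map | ]; try exact: Forall_delta.
Qed.

(** The default 0 at keys outside the basis puts all values into A. *)
Definition descend (h : seq basis -> alg bounded k) (l : seq F) : F :=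
  fun q => if key s t Rel N q is Some b then ext (fun w => h w b) l else 0.

Lemma descend_cochain n h : cochain n (descend h).
Proof.
split=> [l _ _ q nq|l1 l2 x y c _ _ _ _ _ q].
  by rewrite /descend key_None //; apply: negbTE.
rewrite /descend; case: key => [b|]; last by rewrite mulr0 addr0.
exact: ext_multilinear.
Qed.

Lemma descend_basis h l b : descend h l (ssval b) = ext (fun w => h w b) l.
Proof. by rewrite /descend /key valK. Qed.

Lemma gbracket_coboundary p q (f g : seq F -> F) :
    relations_are_paths s t Rel -> triangular s t -> string_S3 s t Rel ->
    gentle_G1 s t Rel -> cocycle s t Rel p.+2 f -> cocycle s t Rel q.+2 g ->
  coboundary s t Rel (p + q).+2 (gbracket p.+2 q.+2 f g).
Proof.
move=> rel_path acyclic S3 G1 cf cg.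
have [h hP] := bracket_exact_gentle rel_path acyclic S3 G1 (to_alg_cocycle cf) (to_alg_cocycle cg).
have [fc gc] := (cf.1, cg.1).
exists (descend h); split=> [|l sl Al r]; first exact: descend_cochain.
(* Basis coordinates say nothing about invalid keys, so both sides are shown to vanish there
   separately. *)
have gcircA p' q' f' g' : cochain p'.+2 f' -> cochain q'.+2 g' ->
    size l = (p' + q').+3 -> ~~ valid r -> gcirc p'.+2 q'.+2 f' g' l r = 0.
  move=> fc' gc' sl' nr; apply: big1 => j _; have jp := ltn_ord j.
  rewrite fc'.1 ?mulr0 //.
    by rewrite size_cat /= size_takel ?size_drop sl'; lia.
  apply/Forall_cat; split; first exact: Forall_take.
  constructor; last exact: Forall_drop.
  apply: gc'.1; last exact/Forall_take/Forall_drop.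
  by rewrite size_takel // size_drop sl'; lia.
case vr: (valid r); last first.
  rewrite /gbracket !gcircA ?vr // 1?addnC // mulr0 subr0.
  rewrite /hoch_diff /mulF vr add0r mulr0 addr0 big1 // => i _.
  by rewrite /descend key_None ?mulr0.
have [b [_ sb ab]] := key_valid bounded vr.
have -> : r = ssval b by rewrite [r]surjective_pairing -sb -ab -surjective_pairing.
rewrite (gbracket_ext _ fc gc) //; last by rewrite sl addSn addnS.
rewrite hoch_diff_ext //; last exact: descend_cochain.
apply: eq_ext => w sw; have := hP w; rewrite addSn addnS sw sl => /(_ erefl)/ffunP/(_ b).
rewrite ffunE !coef_to_alg => ->; rewrite (@hd_brk _ _ _ _ _ _ _ _ (p + q).+1) ?sw //.
congr (- _); apply: eq_brk => // [v c _|]; last by rewrite sw sl addn1.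
by rewrite /coord descend_basis ext_delta.
Qed.

End Coordinates.

Theorem theorem3p2 (k : fieldType) (V E : finType) (s t : E -> V) (Rel : rel E)
  (hrel : relations_are_paths s t Rel)
  (hadm : admissible s t Rel)
  (htri : triangular s t)
  (hS2 : string_S2 s t)
  (hS3 : string_S3 s t Rel)
  (hG1 : gentle_G1 s t Rel)
  (n m : nat) (hn : (1 < n)%N) (hm : (1 < m)%N)
  (f g : seq (F V E k) -> F V E k) :
  cocycle s t Rel n f -> cocycle s t Rel m g ->
  coboundary s t Rel (n + m - 2) (gbracket n m f g).
Proof.
case: hadm => N bounded.
case: n hn => [|[|p]] // _; case: m hm => [|[|q]] // _ cf cg.
(* [coboundary] is indexed by one less than the degree [n + m - 1] of the bracket. *)
have -> : (p.+2 + q.+2 - 2 = (p + q).+2)%N by lia.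
exact: (gbracket_coboundary bounded).
Qed.
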